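(* Let $d\ge 2$ be an integer. There is a constant $C_d>0$ depending only on $d$ such that, for all sufficiently large $n$ (in terms of $d$), every set $P$ of $n$ points in $\mathbb{R}^d$ in general position contains a crossing family of size at least $C_2\sqrt{n}$ if $d=2$, and of size at least $$C_d\, n^{\frac{1}{2\prod_{i=3}^{d}(i^2-i+1)}}$$ if $d\ge 3$.
   Context: A point set in $\mathbb{R}^d$ is in general position if no $d+1$ of its members lie on a common hyperplane. A $(d-1)$-simplex in $P$ is a $(d-1)$-dimensional simplex obtained as the convex hull of $d$ points of $P$. Two $(d-1)$-simplices in $P$ strongly cross if their (relative) interiors intersect and they do not share a common vertex. A crossing family of size $m$ in $P$ is a set of $m$ pairwise strongly crossing $(d-1)$-simplices in $P$. *)

(* Defs.v *)
From HB Require Import structures.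
From mathcomp Require Import all_boot all_order all_algebra finmap.
From mathcomp Require Import all_classical all_reals all_analysis.
Import Order.TTheory GRing.Theory Num.Theory.
Import numFieldNormedType.Exports.

Set Implicit Arguments.
Unset Strict Implicit.
Unset Printing Implicit Defensive.

Local Open Scope classical_set_scope.
Local Open Scope ring_scope.

Section Geometry.
Context {R : realType} {d : nat}.
Implicit Types (P S T : {fset 'rV[R]_d}) (x y v : 'rV[R]_d).

Definition hyperplane (a : 'cV[R]_d) (b : R) : set 'rV[R]_d :=
  [set x | (x *m a) 0 0 = b].

Definition general_position P : Prop :=
  forall S, (S `<=` P)%fset -> #|` S| = d.+1 ->
    ~ exists (a : 'cV[R]_d) (b : R),
        a != 0 /\ (forall v, v \in S -> hyperplane a b v).

Definition affine_hull S : set 'rV[R]_d :=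
  [set x | exists w : 'rV[R]_d -> R,
     \sum_(v <- S) w v = 1 /\ x = \sum_(v <- S) w v *: v].

Definition convex_hull S : set 'rV[R]_d :=
  [set x | exists w : 'rV[R]_d -> R,
     [/\ forall v, v \in S -> 0 <= w v,
         \sum_(v <- S) w v = 1
       & x = \sum_(v <- S) w v *: v]].

Definition affinely_independent S : Prop :=
  forall w : 'rV[R]_d -> R,
    \sum_(v <- S) w v = 0 -> \sum_(v <- S) w v *: v = 0 ->
    forall v, v \in S -> w v = 0.

(* Interior of the convex hull of S in the subspace topology of its affine
   hull. *)
Definition relative_interior S : set 'rV[R]_d :=
  [set x | affine_hull S x /\
     \forall y \near x, affine_hull S y -> convex_hull S y].

(* A simplex is represented by its vertex set, which determines it and is
   determined by it; affine independence of the d vertices says that their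
   convex hull has dimension d - 1. *)
Definition simplex_in P S : Prop :=
  [/\ (S `<=` P)%fset, #|` S| = d & affinely_independent S].

Definition strongly_cross S T : Prop :=
  relative_interior S `&` relative_interior T !=set0 /\ [disjoint S & T]%fset.

Definition crossing_family P (F : {fset {fset 'rV[R]_d}}) : Prop :=
  (forall S, S \in F -> simplex_in P S) /\
  (forall S T, S \in F -> T \in F -> S != T -> strongly_cross S T).

End Geometry.

(* Main.v *)
Require Import Defs.
From HB Require Import structures.
From mathcomp Require Import all_boot all_order all_algebra finmap.
From mathcomp Require Import all_classical all_reals all_analysis.
From mathcomp Require Import fintype finset zify ring lra.
Import Order.TTheory GRing.Theory Num.Theory.
Import numFieldNormedType.Exports.
Set Implicit Arguments.
Unset Strict Implicit.
Unset Printing Implicit Defensive.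
Local Open Scope ring_scope.

(* Points x of R^d are replaced by the vectors (1, x) of R^(d+1).  General
   position means that any d+1 of these vectors are independent, and two disjoint
   simplices cross strongly iff some positive combinations of their vertices
   coincide.  This is invariant under positive rescaling, so that the projection
   from a point is a quotient by a vector.

   Planar case.  Separate two halves A and B of the set by a line L and choose on L
   a median of the |A||B| points where L meets the segments ab.  Up to exchanging A
   and B, some positive fraction X of one side then sees two positive fractions Y1,
   Y2 of the other side respectively below and above the median.  By
   Erdos-Szekeres, about |X|^(1/2) points of X appear in the same order from all
   points of Y1, or from all points of Y2; a second application, inside that Yi,
   makes half of this chain and a chain of Yi mutually avoiding.

   Step from d-1 to d.  With M twice the wanted size, split off a set B of 2k points
   by a hyperplane, where k points suffice for M crossing simplices in dimension
   d-1.  A greedy choice of hyperplanes spanned by B, and the bound (s+1)^d on the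
   number of cells of s hyperplanes, give M points on the other side of which any
   two are separated by only O(k) hyperplanes spanned by B.  After deleting half of B,
   few of these hyperplanes pass through any given point of B.  Project B from one
   of the M points and take M crossing (d-2)-simplices.  Some cyclic shift matches
   the M points with these simplices so that a pair of cones over them is spoilt by
   a separating hyperplane at most M/2 times; all other pairs of cones cross. *)

(** * Linear forms and general position *)

Lemma subset_between (I : finType) (T U : {set I}) n :
  T \subset U -> (#|T| <= n)%N -> (n <= #|U|)%N ->
  exists T' : {set I}, [/\ T \subset T', T' \subset U & #|T'| = n].
Proof.
move=> sTU; elim: n => [|n IH] cT cU.
  by exists T; split=> //; apply/eqP; rewrite -leqn0.
move: cT; rewrite leq_eqVlt => /orP[/eqP cT|cT]; first by exists T.
have [T' [sTT' sT'U cT']] := IH cT (ltnW cU).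
have /set0Pn[x /setDP[xU xT']] : U :\: T' != set0.
  by rewrite -card_gt0 cardsD (setIidPr sT'U) cT' subn_gt0.
exists (x |: T'); split; first exact: subset_trans sTT' (subsetUr _ _).
  by rewrite subUset sub1set xU.
by rewrite cardsU1 xT' cT'.
Qed.

Lemma subset_card (I : finType) (U : {set I}) n : (n <= #|U|)%N ->
  exists2 T : {set I}, T \subset U & #|T| = n.
Proof.
move=> cU; have [|//|T [_ sT cT]] := @subset_between _ set0 U n (sub0set _).
  by rewrite cards0.
by exists T.
Qed.

Section LinearForms.
Context {R : realFieldType} {D : nat}.
Implicit Types (h : 'cV[R]_D) (x y : 'rV[R]_D).

Definition pairing h x : R := (x *m h) 0 0.

Lemma pairing0 h : pairing h 0 = 0.
Proof. by rewrite /pairing mul0mx mxE. Qed.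

Lemma pairingD h x y : pairing h (x + y) = pairing h x + pairing h y.
Proof. by rewrite /pairing mulmxDl mxE. Qed.

Lemma pairingN h x : pairing h (- x) = - pairing h x.
Proof. by rewrite /pairing mulNmx mxE. Qed.

Lemma pairingB h x y : pairing h (x - y) = pairing h x - pairing h y.
Proof. by rewrite pairingD pairingN. Qed.

Lemma pairingZ h a x : pairing h (a *: x) = a * pairing h x.
Proof. by rewrite /pairing -scalemxAl mxE. Qed.

Lemma pairing_sum (I : finType) (A : {set I}) (w : I -> R) (v : I -> 'rV[R]_D) h :
  pairing h (\sum_(u in A) w u *: v u) = \sum_(u in A) w u * pairing h (v u).
Proof.
rewrite /pairing mulmx_suml summxE; apply: eq_bigr => u _.
by rewrite -scalemxAl mxE.
Qed.

Lemma pairingBl h1 h2 x : pairing (h1 - h2) x = pairing h1 x - pairing h2 x.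
Proof. by rewrite /pairing mulmxBr !mxE. Qed.

Lemma pairingZl a h x : pairing (a *: h) x = a * pairing h x.
Proof. by rewrite /pairing -scalemxAr mxE. Qed.

End LinearForms.

Lemma pairingM (R : realFieldType) (D E : nat) (g : 'M[R]_(D, E)) (h : 'cV[R]_E)
    (x : 'rV[R]_D) :
  pairing (g *m h) x = pairing h (x *m g).
Proof. by rewrite /pairing mulmxA. Qed.

Lemma pairing_delta (R : realFieldType) (D : nat) (h : 'cV[R]_D) (i : 'I_D) :
  pairing h (delta_mx 0 i) = h i 0.
Proof. by rewrite /pairing -rowE mxE. Qed.

(** A change of coordinates: it turns a given form into the first coordinate, or the centre of a
    projection into the first basis vector. *)
Lemma complete_row (R : realFieldType) (D : nat) (x : 'rV[R]_D.+1) :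
  x != 0 -> {g : 'M[R]_D.+1 | g \in unitmx & delta_mx 0 0 *m g = x}.
Proof.
move=> x0; set f : 'M[R]_D.+1 := \matrix_(i < D.+1) x.
have fE : (delta_mx 0 0 : 'rV_D.+1) *m f = x by rewrite -rowE rowK.
have [|g gU eg] := @complete_unitmx R 1 D.+1 (delta_mx 0 0) f.
  by rewrite fE rank_rV x0 mxrank_delta.
by exists g; rewrite // -eg.
Qed.

Section Independence.
Context {R : realFieldType} {D : nat} {I : finType} (v : I -> 'rV[R]_D).
Implicit Types (U T : {set I}) (w : I -> R).

(** Independence of the family indexed by [U]: two indices with equal vectors already violate it. *)
Definition independent U :=
  forall w, \sum_(u in U) w u *: v u = 0 -> forall u, u \in U -> w u = 0.

Let rows U : 'M[R]_(#|U|, D) := \matrix_(i < #|U|) v (enum_val i).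

Let weights U (r : 'rV[R]_#|U|) u := \sum_(i | enum_val i == u) r 0 i.

Let weightsK U (r : 'rV[R]_#|U|) i : weights r (enum_val i) = r 0 i.
Proof. by rewrite /weights (eq_bigl _ _ (fun j => inj_eq enum_val_inj j i)) big_pred1_eq. Qed.

Let mul_rows U (r : 'rV[R]_#|U|) :
  r *m rows U = \sum_(u in U) weights r u *: v u.
Proof.
rewrite big_enum_val /= mulmx_sum_row; apply: eq_bigr => i _.
by rewrite weightsK rowK.
Qed.

Let independent_row_free U : independent U -> row_free (rows U).
Proof.
move=> indU; rewrite -kermx_eq0; apply/eqP/row_matrixP => i; rewrite row0.
have /indU w0 : \sum_(u in U) weights (row i (kermx (rows U))) u *: v u = 0.
  by rewrite -mul_rows; apply/sub_kermxP; rewrite row_sub.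
apply/rowP => j; rewrite [RHS]mxE -weightsK.
by apply: w0; apply: enum_valP.
Qed.

Lemma independent_card U : independent U -> (#|U| <= D)%N.
Proof. by move/independent_row_free => /eqP <-; apply: rank_leq_col. Qed.

Lemma independent_span U x : independent U -> #|U| = D ->
  exists w, x = \sum_(u in U) w u *: v u.
Proof.
move=> /independent_row_free /eqP rU cU.
have /submx_full-/(_ _ x)/submxP[r ->] : row_full (rows U).
  by rewrite /row_full rU cU.
by exists (weights r); rewrite mul_rows.
Qed.

(** The transposed matrix of the vectors has rank at most [#|U|], hence a nonzero left kernel. *)
Lemma vanishing_form U : (#|U| < D)%N ->
  exists2 h : 'cV[R]_D, h != 0 & forall u, u \in U -> pairing h (v u) = 0.
Proof.
move=> cU; have : kermx (rows U)^T != 0.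
  rewrite kermx_eq0 /row_free neq_ltn.
  by rewrite (leq_ltn_trans (rank_leq_col _) cU).
case/rowV0Pn => r /sub_kermxP rk r0; exists r^T.
  by apply: contra r0 => /eqP h0; rewrite -[r]trmxK h0 trmx0.
move=> u uU; rewrite /pairing.
have : (rows U *m r^T) = 0 by rewrite -[rows U]trmxK -trmx_mul rk trmx0.
move/(congr1 (row (enum_rank_in uU u))); rewrite row_mul rowK enum_rankK_in //.
by move=> ->; rewrite !mxE.
Qed.

Lemma form_eq0 U (h : 'cV[R]_D) : independent U -> #|U| = D ->
  (forall u, u \in U -> pairing h (v u) = 0) -> h = 0.
Proof.
move=> indU cU hU; apply/colP => i; rewrite mxE -pairing_delta.
have [w ->] := independent_span (delta_mx 0 i) indU cU.
by rewrite pairing_sum big1 // => u uU; rewrite hU ?mulr0.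
Qed.

Lemma independentS U T : T \subset U -> independent U -> independent T.
Proof.
move=> sTU indU w w0 u uT.
have := indU (fun u => if u \in T then w u else 0); rewrite /=.
rewrite (bigID (mem T)) /= [X in _ + X]big1 ?addr0; last first.
  by move=> i /andP[_ /negbTE ->]; rewrite scale0r.
rewrite (eq_bigl (fun i => i \in T)); last first.
  by move=> i /=; case: (boolP (i \in T)) => [/(subsetP sTU) ->|]; rewrite ?andbF.
rewrite (eq_bigr (fun u => w u *: v u)); last by move=> i /= ->.
by move=> /(_ w0 u); rewrite uT (subsetP sTU) // => /(_ isT).
Qed.

Lemma independent_neq0 U u : independent U -> u \in U -> v u != 0.
Proof.
move=> indU uU; apply/eqP => v0.
have /indU /(_ u uU) /eqP : \sum_(t in U) (t == u)%:R *: v t = 0.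
  rewrite big1 // => t _; case: eqP => [->|_]; first by rewrite v0 scaler0.
  by rewrite scale0r.
by rewrite eqxx oner_eq0.
Qed.

(** General position after lifting. It is void when [U] has fewer than [D] elements, so later
    statements bound the size of the set from below. *)
Definition general U := forall T, T \subset U -> #|T| = D -> independent T.

Lemma general_independent U T : general U -> T \subset U -> (#|T| <= D)%N ->
  (D <= #|U|)%N -> independent T.
Proof.
move=> gU sTU cT cU; have [T' [sTT' sT'U cT']] := subset_between sTU cT cU.
exact: independentS sTT' (gU _ sT'U cT').
Qed.

End Independence.

(** * Crossing cones *)

Lemma small_perturbation (R : realFieldType) (I : finType) (U : {set I})
    (g y : I -> R) : (forall u, u \in U -> 0 < g u) ->
  exists2 eps, 0 < eps & forall u, u \in U -> 0 < g u + eps * y u.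
Proof.
(* [E] exceeds every ratio |y u| / g u, so its inverse can serve as [eps]. *)
move=> g0; pose E := 1 + \sum_(u in U) `|y u| / g u.
have pos u : u \in U -> 0 <= `|y u| / g u by move=> uU; rewrite divr_ge0 // ltW // g0.
have E0 : 0 < E by rewrite ltr_pwDl // sumr_ge0.
exists E^-1 => [|u uU]; first by rewrite invr_gt0.
have ltE : `|y u| / g u < E.
  rewrite /E (bigD1 u) //= addrCA ltrDl ltr_pwDl // sumr_ge0 // => i /andP[iU _].
  exact: pos.
have : E^-1 * `|y u| < g u.
  by rewrite mulrC ltr_pdivrMr // mulrC -ltr_pdivrMr // g0.
have : - (E^-1 * `|y u|) <= E^-1 * y u.
  by rewrite -mulrN ler_pM2l ?invr_gt0 // lerNl ler_normr lexx orbT.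
lra.
Qed.

Section Crossing.
Context {R : realFieldType} {I : finType}.

(** Caratheodory's theorem for cones: a multiple of a linear dependency is subtracted from the
    weights until one of them vanishes, and its index is dropped. *)
Lemma caratheodory D (v : I -> 'rV[R]_D) (U : {set I}) (g : I -> R) :
    (forall u, u \in U -> 0 <= g u) ->
  exists (T : {set I}) (g' : I -> R), [/\ T \subset U, independent v T,
    forall u, u \in T -> 0 < g' u
    & \sum_(u in U) g u *: v u = \sum_(u in T) g' u *: v u].
Proof.
elim: #|U| {-2}U (leqnn #|U|) g => {U} [|n IH] U cU g g0.
  exists U, g; move: cU; rewrite leqn0 cards_eq0 => /eqP ->; split => //.
  - by move=> w _ u; rewrite inE.
  - by move=> u; rewrite inE.
have drop u1 (g1 : I -> R) : u1 \in U -> g1 u1 = 0 ->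
    (forall u, u \in U -> 0 <= g1 u) ->
    \sum_(u in U) g u *: v u = \sum_(u in U) g1 u *: v u ->
  exists (T : {set I}) (g' : I -> R), [/\ T \subset U, independent v T,
    forall u, u \in T -> 0 < g' u
    & \sum_(u in U) g u *: v u = \sum_(u in T) g' u *: v u].
  move=> u1U g1u1 g1pos eqg.
  have [||T [g' [sT indT g'pos eqT]]] := IH (U :\ u1) _ g1.
  - by move: cU; rewrite (cardsD1 u1) u1U.
  - by move=> u /setD1P[_ /g1pos].
  exists T, g'; split=> //; first exact: subset_trans sT (subD1set _ _).
  by rewrite eqg -eqT (big_setD1 u1) //= g1u1 scale0r add0r.
have [/existsP[u1 /andP[u1U /eqP g1]]|] := boolP [exists u1, (u1 \in U) && (g u1 == 0)].
  exact: (drop u1 g).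
rewrite negb_exists => /forallP gn0.
have gpos u : u \in U -> 0 < g u.
  by move=> uU; rewrite lt_neqAle eq_sym g0 // andbT; have := gn0 u; rewrite uU.
have [indU|] := pselect (independent v U); first by exists U, g; split.
move=> /existsNP[w0 /not_implyP[sw0 /existsNP[u0 /not_implyP[u0U /eqP w0u0]]]].
have [w [sw wu0]] : exists w : I -> R, \sum_(u in U) w u *: v u = 0 /\ 0 < w u0.
  have [w0pos|w0neg] := ltP 0 (w0 u0); first by exists w0.
  exists (fun u => - w0 u); split; last by rewrite oppr_gt0 lt_neqAle w0u0.
  by under eq_bigr do rewrite scaleNr; rewrite sumrN sw0 oppr0.
have P0 : (u0 \in U) && (0 < w u0) by rewrite u0U.
(* [u1] minimises g u / w u over the positive w u. This multiple of the dependency cancels the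
   weight of [u1] and keeps all others nonnegative. *)
case: (@arg_minP _ _ _ u0 (fun u => (u \in U) && (0 < w u)) (fun u => g u / w u) P0).
move=> u1 /andP[u1U wu1] min1.
pose t := g u1 / w u1; have t0 : 0 <= t by rewrite divr_ge0 ?g0 // ltW.
apply: (drop u1 (fun u => g u - t * w u)) => //.
- by rewrite /t divfK ?subrr // gt_eqF.
- move=> u uU; rewrite subr_ge0; have [wu|wu] := ltP 0 (w u).
    by rewrite -ler_pdivlMr //; apply: min1; rewrite uU.
  by apply: le_trans (g0 u uU); rewrite mulr_ge0_le0.
- under [RHS]eq_bigr do rewrite scalerBl -scalerA.
  by rewrite sumrB -scaler_sumr sw scaler0 subr0.
Qed.

(** The open cones over [S] and [T] have a common vector. One weight function serves both sides,
    since the sets it is applied to are disjoint. *)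
Definition cone_cross D (v : I -> 'rV[R]_D) (S T : {set I}) :=
  exists2 w : I -> R, (forall u, u \in S :|: T -> 0 < w u) &
    \sum_(u in S) w u *: v u = \sum_(u in T) w u *: v u.

Lemma cone_crossC D (v : I -> 'rV[R]_D) S T : cone_cross v S T -> cone_cross v T S.
Proof. by case=> w w0 ew; exists w => //; rewrite setUC. Qed.

Let side (S : {set I}) u : R := if u \in S then 1 else -1.

Let sideK S u : side S u * side S u = 1.
Proof. by rewrite /side; case: ifP => _; rewrite ?mulr1 ?mulrNN ?mulr1. Qed.

Let signed_sum D (v : I -> 'rV[R]_D) (S T : {set I}) (w : I -> R) : [disjoint S & T] ->
  \sum_(u in S :|: T) (side S u * w u) *: v u =
  \sum_(u in S) w u *: v u - \sum_(u in T) w u *: v u.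
Proof.
move=> dST; rewrite (eq_bigl [predU S & T]); last by move=> u; rewrite !inE.
rewrite bigU //= -sumrN; congr (_ + _); apply: eq_bigr => u uS.
  by rewrite /side uS mul1r.
by rewrite /side (disjointFl dST uS) mulN1r scaleNr.
Qed.

(* [v x0] makes the cones over [x0 |: S] and [T] meet; by Caratheodory this
   is witnessed by a basis contained in [S :|: T], in which [v a] has
   coordinates of the same signs as [v x0]. *)
Lemma cone_cross_transfer E (v : I -> 'rV[R]_E.+1) (W S T : {set I}) x0 a b
    (w : I -> R) (c : R) :
  general v W -> S :|: T \subset W -> [disjoint S & T] -> (E < #|S :|: T|)%N ->
  x0 \in W -> x0 \notin S :|: T -> a \notin S :|: T -> b \notin S :|: T -> a != b ->
  (forall u, u \in S :|: T -> 0 < w u) -> 0 <= c ->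
  \sum_(u in S) w u *: v u + c *: v x0 = \sum_(u in T) w u *: v u ->
  (forall P : {set I}, P \subset S :|: T -> #|P| = E ->
     exists2 h, forall u, u \in P -> pairing h (v u) = 0 &
       0 < pairing h (v x0) * pairing h (v a)) ->
  cone_cross v (a |: S) (b |: T).
Proof.
move=> genW sXW dST cX x0W x0X aX bX ab w0 c0 eqw nosep.
set X := S :|: T in sXW cX x0X aX bX w0 nosep *.
have cW : (E < #|W|)%N by apply: leq_trans (subset_leq_card sXW).
(* The relation expresses [- (c *: v x0)] through the signed vectors. As [c] may be 0, a small
   multiple of an expansion of [v x0] in a basis is added, too small to spoil the positive
   weights. *)
have [g [gpos eqg]] : exists g : I -> R, (forall u, u \in X -> 0 <= g u) /\
    - v x0 = \sum_(u in X) g u *: (side S u *: v u).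
  have [B sBX cB] := subset_card cX.
  have [y ey] := independent_span (v x0) (genW B (subset_trans sBX sXW) cB) cB.
  pose y' u := if u \in B then y u else 0.
  have ey' : v x0 = \sum_(u in X) y' u *: v u.
    rewrite ey [RHS](big_setID B) /= (setIidPr sBX) [Y in _ + Y]big1 ?addr0.
      by apply: eq_bigr => u uB; rewrite /y' uB.
    by move=> u /setDP[_ /negbTE uB]; rewrite /y' uB scale0r.
  have [eps e0 ew] := small_perturbation (fun u => - side S u * y' u) w0.
  have ce : 0 < c + eps by rewrite ltr_wpDl.
  exists (fun u => (c + eps)^-1 * (w u + eps * (- side S u * y' u))); split.
    by move=> u uX; rewrite mulr_ge0 ?invr_ge0 ?ltW // ew.
  have eX : \sum_(u in X) (side S u * w u) *: v u = - (c *: v x0).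
    by rewrite signed_sum // -eqw opprD addrA subrr add0r.
  under eq_bigr => u uX.
    have -> : (c + eps)^-1 * (w u + eps * (- side S u * y' u)) *: (side S u *: v u)
        = (c + eps)^-1 *: ((side S u * w u) *: v u - eps *: (y' u *: v u)).
      rewrite !scalerA -scalerBl scalerA; congr (_ *: _).
      rewrite -mulrA; congr (_ * _).
      have := sideK S u; set s := side S u => ss.
      rewrite mulrDl; congr (_ + _); first by rewrite mulrC.
      by rewrite -[in RHS](mul1r (y' u)) -ss; ring.
    over.
  rewrite -scaler_sumr sumrB eX -scaler_sumr -ey' -opprD -scalerDl scalerN scalerA.
  by rewrite mulVf ?gt_eqF // scale1r.
have [B [g' [sBX indB g'pos]]] := caratheodory (fun u => side S u *: v u) gpos.
rewrite -eqg => eqg'.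
have genB : forall u, u \in B -> u \in W by move=> u /(subsetP sBX) /(subsetP sXW).
have sBW : B \subset W by apply/subsetP.
(* With at most E elements, [B] together with [x0] would be independent, against the relation just
   found. *)
have cB : #|B| = E.+1.
  apply/eqP; rewrite eqn_leq (independent_card indB) /= ltnNge; apply/negP => cBE.
  have x0B : x0 \notin B by apply: contra x0X; apply: subsetP.
  have ind0 : independent v (x0 |: B).
    apply: general_independent genW _ _ cW; first by rewrite subUset sub1set x0W.
    by rewrite cardsU1 x0B.
  have := ind0 (fun u => if u == x0 then 1 else g' u * side S u).
  rewrite big_setU1 //= eqxx scale1r.
  have -> : \sum_(u in B) (if u == x0 then 1 else g' u * side S u) *: v u = - v x0.
    rewrite eqg'; apply: eq_bigr => u uB; rewrite scalerA.
    by case: eqP => // ux0; move: x0B; rewrite -ux0 uB.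
  rewrite subrr => /(_ erefl x0); rewrite setU11 eqxx => /(_ isT) /eqP.
  by rewrite oner_eq0.
have indvB : independent v B := genW _ sBW cB.
have [y ey] := independent_span (v a) indvB cB.
(* A form vanishing on [B :\ u] reads off the coefficient of [u]. It has the same sign at [v x0] and
   [v a], so the coefficients of [v a] are opposite to [side]. *)
have ypos u : u \in B -> 0 < - side S u * y u.
  move=> uB; have [||h hP hxa] := nosep (B :\ u).
  - exact: subset_trans (subD1set _ _) sBX.
  - by have := cardsD1 u B; rewrite uB cB => -[].
  have single (z : I -> R) : pairing h (\sum_(t in B) z t *: v t) = z u * pairing h (v u).
    rewrite pairing_sum (big_setD1 u) //= big1 ?addr0 // => t tB.
    by rewrite hP ?mulr0.
  have h0 : pairing h (v x0) = - (g' u * side S u * pairing h (v u)).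
    rewrite -[v x0]opprK pairingN eqg' -(single (fun t => g' t * side S t)); congr (- pairing h _).
    by apply: eq_bigr => t _; rewrite scalerA.
  move: hxa; rewrite h0 ey (single y).
  have -> : - (g' u * side S u * pairing h (v u)) * (y u * pairing h (v u)) =
    (g' u * (- side S u * y u)) * (pairing h (v u)) ^+ 2 by ring.
  move=> hxa; have : 0 < g' u * (- side S u * y u).
    rewrite ltNge; apply/negP => le0; move: hxa; apply/negP; rewrite -leNgt.
    by rewrite mulr_le0_ge0 // sqr_ge0.
  by rewrite pmulr_rgt0 // g'pos.
(* The indices outside [B], and [b], receive the weight [eps]; [z] expresses the error in the basis,
   where the positive weights can absorb it. *)
have [z ez] := independent_span (\sum_(u in X :\: B) side S u *: v u - v b) indvB cB.
have [eps e0 eW] := small_perturbation (fun u => - side S u * z u) ypos.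
pose wt u := if u == a then 1 else if u == b then eps else
  if u \in B then - side S u * y u + eps * (- side S u * z u) else eps.
have wtX u : u \in X -> wt u = if u \in B
    then - side S u * y u + eps * (- side S u * z u) else eps.
  move=> uX; rewrite /wt; case: eqP => [ua|_]; first by move: aX; rewrite -ua uX.
  by case: eqP => // ub; move: bX; rewrite -ub uX.
exists wt.
  move=> u; rewrite /wt; case: eqP => // /eqP ua; case: eqP => // /eqP ub.
  by case: ifP => [/eW|].
move: (aX) (bX); rewrite !inE !negb_or => /andP[aS aT] /andP[bS bT].
rewrite !big_setU1 //= {1 3}/wt eqxx eq_sym (negbTE ab) eqxx scale1r.
apply/eqP; rewrite -subr_eq0 opprD addrACA addrAC -addrA -signed_sum // -/X.
rewrite (big_setID B) /= (setIidPr sBX).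
have -> : \sum_(u in X :\: B) (side S u * wt u) *: v u =
    eps *: \sum_(u in X :\: B) side S u *: v u.
  rewrite scaler_sumr; apply: eq_bigr => u /setDP[uX /negbTE uB].
  by rewrite wtX // uB mulrC scalerA.
have -> : \sum_(u in B) (side S u * wt u) *: v u =
    - v a - eps *: (\sum_(u in X :\: B) side S u *: v u - v b).
  rewrite ez ey scaler_sumr -sumrN -sumrB; apply: eq_bigr => u uB.
  rewrite wtX ?(subsetP sBX) // uB scalerA -scaleNr -scalerBl; congr (_ *: _).
  have := sideK S u; set s := side S u => ss.
  by rewrite -[in RHS](mul1r (y u)) -[in RHS](mul1r (z u)) -ss; ring.
by apply/eqP; rewrite scalerBr opprB !addrA subrr add0r subrK subrr.
Qed.

End Crossing.

(** * The planar case *)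

Section ErdosSzekeres.
Context {I : finType}.

(** Mirsky's argument: the minimal elements [Z] form an antichain. If there are at most b of them, a
    chain found among the rest is extended by an element below its first member. *)
Lemma chain_or_antichain (r : rel I) (X : {set I}) (a b : nat) :
    transitive r -> (a * b < #|X|)%N ->
  (exists s : seq I, [/\ size s = a.+1, {subset s <= X} & pairwise r s]) \/
  (exists Z : {set I}, [/\ Z \subset X, (b < #|Z|)%N &
     forall x y, x \in Z -> y \in Z -> ~~ r x y]).
Proof.
move=> tr; elim: a X => [|a IH] X cX.
  have /card_gt0P[x xX] : (0 < #|X|)%N by [].
  by left; exists [:: x]; split=> // y; rewrite inE => /eqP ->.
pose Z := [set x in X | ~~ [exists y in X, r y x]].
have sZ : Z \subset X by apply/subsetP => x; rewrite inE => /andP[].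
have [bZ|Zb] := ltnP b #|Z|.
  right; exists Z; split=> // x y; rewrite !inE => /andP[xX _] /andP[_].
  by rewrite negb_exists => /forallP/(_ x); rewrite xX.
have [|[[|x s] [sz sub pw]]|[Z' [sZ' bZ' antiZ']]] := IH (X :\: Z).
- rewrite cardsD (setIidPr sZ).
  by move: cX; rewrite mulSn; lia.
- by [].
- have /setDP[xX] := sub x (mem_head _ _).
  rewrite !inE xX /= negbK => /existsP[y /andP[yX ryx]].
  left; exists [:: y, x & s]; split.
  + by rewrite /= -sz.
  + move=> z; rewrite inE => /orP[/eqP -> //|/sub]; by case/setDP.
  + rewrite pairwise_cons pw andbT /= ryx /=; apply/allP => z zs.
    by apply: tr ryx _; move: pw; rewrite pairwise_cons => /andP[/allP/(_ z zs)].
- by right; exists Z'; split=> //; apply: subset_trans sZ' (subsetDl _ _).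
Qed.

(** An antichain for [r1] is searched for chains of [r2]; two distinct points are always comparable
    in one of the two orders. *)
Lemma erdos_szekeres (R : realDomainType) (k1 k2 : I -> R) (X : {set I}) (n : nat) :
    {in X &, forall x y, k1 x = k1 y -> k2 x = k2 y -> x = y} ->
    (n * n < #|X|)%N ->
  exists s : seq I, [/\ size s = n.+1, {subset s <= X}, uniq s &
    pairwise (fun x y => (k1 x <= k1 y) && (k2 x <= k2 y)) s \/
    pairwise (fun x y => (k1 x <= k1 y) && (k2 y <= k2 x)) s].
Proof.
move=> inj cX.
(* [diff] makes both orders irreflexive, so that chains do not repeat elements, while ties in a
   single key stay allowed. *)
pose diff x y := (k1 x != k1 y) || (k2 x != k2 y).
pose r1 x y := [&& k1 x <= k1 y, k2 x <= k2 y & diff x y].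
pose r2 x y := [&& k1 x <= k1 y, k2 y <= k2 x & diff x y].
have tr1 : transitive r1.
  move=> y x z /and3P[a1 a2 a3] /and3P[b1 b2 _].
  rewrite /r1 (le_trans a1 b1) (le_trans a2 b2) /=.
  move: a3; apply: contraTT; rewrite /diff !negb_or !negbK => /andP[/eqP e1 /eqP e2].
  by rewrite -e1 in b1; rewrite -e2 in b2; rewrite !eq_le a1 b1 a2 b2.
have tr2 : transitive r2.
  move=> y x z /and3P[a1 a2 a3] /and3P[b1 b2 _].
  rewrite /r2 (le_trans a1 b1) (le_trans b2 a2) /=.
  move: a3; apply: contraTT; rewrite /diff !negb_or !negbK => /andP[/eqP e1 /eqP e2].
  by rewrite -e1 in b1; rewrite -e2 in b2; rewrite !eq_le a1 b1 a2 b2.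
have irr x : diff x x = false by rewrite /diff !eqxx.
have [[s [sz sub pw]]|[Z [sZ cZ antiZ]]] := chain_or_antichain tr1 cX.
  exists s; split=> //; first by apply: pairwise_uniq pw => x; rewrite /r1 irr !andbF.
  by left; apply: sub_pairwise pw => x y /and3P[-> ->].
have cZ1 : (n * 1 < #|Z|)%N by rewrite muln1.
have [[s [sz sub pw]]|[Z' [sZ' cZ' antiZ']]] := chain_or_antichain tr2 cZ1.
  exists s; split=> //; first by move=> x /sub; apply: subsetP.
    by apply: pairwise_uniq pw => x; rewrite /r2 irr !andbF.
  by right; apply: sub_pairwise pw => x y /and3P[-> ->].
have /card_gt1P[x [y [xZ' yZ' xy]]] := cZ'.
have [xZ yZ] := (subsetP sZ' x xZ', subsetP sZ' y yZ').
have dxy : diff x y.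
  apply: contraNT xy; rewrite negb_or !negbK => /andP[/eqP e1 /eqP e2].
  by apply/eqP/inj => //; apply: (subsetP sZ).
have dyx : diff y x by rewrite /diff (eq_sym (k1 y)) (eq_sym (k2 y)).
move: (antiZ x y xZ yZ) (antiZ y x yZ xZ) (antiZ' x y xZ' yZ') (antiZ' y x yZ' xZ').
rewrite /r1 /r2 dxy dyx !andbT.
by case: (leP (k1 x) (k1 y)) => [_|/ltW ->]; case: (leP (k2 x) (k2 y)) => //= /ltW ->.
Qed.

(** The median is the least value of [k] below or at which at least half of [P] lies. *)
Lemma median (R : realDomainType) (P : {set I}) (k : I -> R) : (0 < #|P|)%N ->
  exists t, (2 * #|[set p in P | (k p < t)%R]| <= #|P|)%N /\
            (2 * #|[set p in P | (t < k p)%R]| <= #|P|)%N.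
Proof.
move=> /card_gt0P[p0 p0P].
pose good p := (p \in P) && (#|P| <= 2 * #|[set q in P | (k q <= k p)%R]|)%N.
have [pm pmP maxp] := arg_maxP k p0P.
have gm : good pm.
  rewrite /good (pmP : pm \in P) (_ : [set q in P | _] = P) ?leq_pmull //.
  by apply/setP => q; rewrite inE andb_idr //; apply: maxp.
have [p /andP[pP cp] minp] := arg_minP k gm.
exists (k p); split.
  rewrite leqNgt; apply/negP => big.
  have /card_gt0P[q0 q0L] : (0 < #|[set q in P | (k q < k p)%R]|)%N by lia.
  have [q qL maxq] := arg_maxP k q0L.
  have /setIdP[qP kq] : q \in [set q in P | (k q < k p)%R] := qL.
  suff /minp : good q by rewrite leNgt kq.
  rewrite /good qP /=; apply: leq_trans (ltnW big) _.
  rewrite leq_pmul2l //; apply: subset_leq_card; apply/subsetP => x xL.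
  by rewrite inE [_ <= _]maxq // andbT; case/setIdP: xL.
have : (#|[set q in P | (k q <= k p)%R]| + #|[set q in P | (k p < k q)%R]| = #|P|)%N.
  rewrite -(cardsID [set q | k q <= k p]%R P); congr (_ + _)%N; apply: eq_card => q.
    by rewrite !inE.
  by rewrite !inE ltNge andbC.
lia.
Qed.

End ErdosSzekeres.

Lemma card_setX_set (I J : finType) (A : {set I}) (B : {set J}) (Q : I -> J -> bool) :
  #|[set p in setX A B | Q p.1 p.2]| = (\sum_(a in A) #|[set b in B | Q a b]|)%N.
Proof.
rewrite -sum1_card; under [RHS]eq_bigr do rewrite -sum1_card.
rewrite pair_big_dep /=; apply: eq_bigl => -[a b].
by rewrite !inE /= andbA.
Qed.

Section Planar.
Context {R : realFieldType} {I : finType} (alpha beta : I -> R).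
Implicit Types (X Y A B : {set I}) (s : seq I).

(* With [a] and [b] scaled to (-1, alpha a, beta a) and (1, alpha b, beta b),
   the segment ab meets the plane of first coordinate 0 in a multiple of
   (0, 1, height a b). *)
Definition height a b := (beta a + beta b) / (alpha a + alpha b).

Lemma heightC a b : height a b = height b a.
Proof. by rewrite /height addrC [alpha a + _]addrC. Qed.

Let heightE a b t : 0 < alpha a -> 0 < alpha b ->
  (t < height a b) = (0 < (beta b - t * alpha b) - (t * alpha a - beta a)).
Proof.
move=> a0 b0; rewrite /height ltr_pdivlMr; last exact: addr_gt0.
by apply/idP/idP => ?; lra.
Qed.

Let heightE' a b t : 0 < alpha a -> 0 < alpha b ->
  (height a b < t) = ((beta b - t * alpha b) - (t * alpha a - beta a) < 0).
Proof.
move=> a0 b0; rewrite /height ltr_pdivrMr; last exact: addr_gt0.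
by apply/idP/idP => ?; lra.
Qed.

Let height_eq a b : 0 < alpha a -> 0 < alpha b ->
  beta a + beta b = height a b * (alpha a + alpha b).
Proof. by move=> a0 b0; rewrite /height divfK // gt_eqF // addr_gt0. Qed.

(* Both endpoints b, b' see a before a', and both a, a' see b' before b. *)
Definition height_cross a b a' b' :=
  [/\ height a' b < height a b, height a' b' < height a b',
      height a b < height a b' & height a' b < height a' b'].

(** A violation would put three of the points on one line of the plane. *)
Definition nondegenerate A B :=
  (forall a b b', a \in A -> b \in B -> b' \in B -> height a b = height a b' -> b = b')
  /\ (forall b a a', b \in B -> a \in A -> a' \in A -> height a b = height a' b -> a = a').

Let pos A B := forall u, u \in A :|: B -> 0 < alpha u.

Let posl A B : pos A B -> forall a, a \in A -> 0 < alpha a.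
Proof. by move=> p a aA; apply: p; rewrite inE aA. Qed.

Let posr A B : pos A B -> forall b, b \in B -> 0 < alpha b.
Proof. by move=> p a aA; apply: p; rewrite inE aA orbT. Qed.

(** The order in which a sees b and b' is the sign, at [height a b], of an affine function that
    depends on b and b' only. *)
Let lt_height_affine a b b' : 0 < alpha a -> 0 < alpha b -> 0 < alpha b' ->
  (height a b < height a b') =
  (0 < (beta b' - beta b) - height a b * (alpha b' - alpha b)).
Proof.
move=> a0 b0 b'0; rewrite heightE //.
by have := height_eq a0 b0; set h := height a b => e; apply/idP/idP => ?; lra.
Qed.

Let gt_height_affine a b b' : 0 < alpha a -> 0 < alpha b -> 0 < alpha b' ->
  (height a b' < height a b) =
  ((beta b' - beta b) - height a b * (alpha b' - alpha b) < 0).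
Proof.
move=> a0 b0 b'0; rewrite heightE' //.
by have := height_eq a0 b0; set h := height a b => e; apply/idP/idP => ?; lra.
Qed.

Let affine_between (p q u w v : R) :
  0 < p - u * q -> 0 < p - v * q -> u <= w -> w <= v -> 0 < p - w * q.
Proof. by move=> ? ? ? ?; case: (lerP 0 q) => ?; nra. Qed.

Let affine_beyond (p q u w v : R) :
  0 < p - v * q -> p - u * q < 0 -> w <= v -> v <= u -> 0 < p - w * q.
Proof. by move=> ? ? ? ?; case: (lerP 0 q) => ?; nra. Qed.

(* For consecutive points [xs] seen in the same order from all of [Y], a
   line through two points of [Y] either misses the first half of [xs] or
   misses the second half. *)
Lemma chain_grid A Y (xs : seq I) m :
    pos A Y -> nondegenerate A Y -> {subset xs <= A} ->
    (forall y, y \in Y -> pairwise (fun x x' => height x' y < height x y) xs) ->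
    size xs = m.*2.+2 -> (m * m < #|Y|)%N ->
  exists zs ys : seq I, [/\ {subset zs <= xs} /\ uniq zs, {subset ys <= Y} /\ uniq ys,
    size zs = m.+1, size ys = m.+1 &
    forall z0 y0 i j, (i < j < m.+1)%N ->
      height_cross (nth z0 zs i) (nth y0 ys i) (nth z0 zs j) (nth y0 ys j)].
Proof.
move=> pAY [ndl ndr] sxs dec sz cY.
have [x0 x0xs] : exists x, x \in xs.
  by case: xs sz {sxs dec} => // x xs _; exists x; rewrite mem_head.
pose x i := nth x0 xs i.
have xxs i : (i < m.*2.+2)%N -> x i \in xs by move=> ?; rewrite mem_nth // sz.
have xA i : (i < m.*2.+2)%N -> x i \in A by move/xxs/sxs.
have xdec y i j : y \in Y -> (i < j < m.*2.+2)%N -> height (x j) y < height (x i) y.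
  move=> yY /andP[ij jm]; have /(pairwiseP x0) := dec y yY.
  by apply; rewrite ?inE ?sz // (ltn_trans ij).
have xle y i j : y \in Y -> (i <= j)%N -> (j < m.*2.+2)%N ->
    height (x j) y <= height (x i) y.
  move=> yY; rewrite leq_eqVlt => /orP[/eqP -> //|ij] jm.
  by apply/ltW/xdec => //; rewrite ij.
have m0 : (0 < m.*2.+2)%N by [].
have mm : (m.+1 < m.*2.+2)%N by lia.
(* The two keys are the heights seen from the point in the middle of [xs] and from its first
   point. *)
have [||ys [szy sys uys chy]] := @erdos_szekeres _ _ (height (x m.+1)) (height (x 0)) Y m.
- by move=> y y' yY y'Y /ndl -> //; apply: xA.
- exact: cY.
pose y j := nth x0 ys j.
have yys j : (j < m.+1)%N -> y j \in ys by move=> ?; rewrite mem_nth // szy.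
have yY j : (j < m.+1)%N -> y j \in Y by move/yys/sys.
have posx i : (i < m.*2.+2)%N -> 0 < alpha (x i) by move/xA => /(posl pAY).
have posy j : (j < m.+1)%N -> 0 < alpha (y j) by move/yY => /(posr pAY).
have strict k i j : (k < m.*2.+2)%N -> (i < j)%N -> (j < m.+1)%N ->
    height (x k) (y i) != height (x k) (y j).
  move=> km ij jm; apply/eqP => /ndl e.
  have /eqP : y i = y j by apply: e; rewrite ?xA ?yY // (ltn_trans ij).
  by rewrite nth_uniq ?szy ?(ltn_trans ij) // ltn_eqF.
(* If both viewpoints see the chain in the same order, the comparing affine function is positive
   between them, which covers the first half of [xs]. If they see opposite orders, it keeps its sign
   beyond the middle point, which covers the second half. *)
have [off [offm inc]] : exists off, (off <= m.+1)%N /\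
    forall i j k, (i < j)%N -> (j < m.+1)%N -> (k <= m)%N ->
      height (x (off + k)%N) (y i) < height (x (off + k)%N) (y j).
  case: chy => /(pairwiseP x0) chy; [exists 0%N | exists m.+1]; split=> // i j k ij jm km;
    have im := ltn_trans ij jm;
    (have iys : i \in gtn (size ys) by rewrite inE szy);
    (have jys : j \in gtn (size ys) by rewrite inE szy);
    have /andP[le1 le2] := chy i j iys jys ij;
    have n2 := strict 0%N i j m0 ij jm; have n1 := strict m.+1 i j mm ij jm.
  - have l1 : height (x m.+1) (y i) < height (x m.+1) (y j) by rewrite lt_neqAle n1.
    have l2 : height (x 0%N) (y i) < height (x 0%N) (y j) by rewrite lt_neqAle n2.
    rewrite add0n; have km2 : (k < m.*2.+2)%N by clear -km; lia.
    rewrite lt_height_affine ?posx ?posy // in l1.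
    rewrite lt_height_affine ?posx ?posy // in l2.
    rewrite lt_height_affine ?posx ?posy //.
    apply: (affine_between l1 l2); apply: xle; rewrite ?yY //; clear -km; lia.
  - have l1 : height (x m.+1) (y i) < height (x m.+1) (y j) by rewrite lt_neqAle n1.
    have l2 : height (x 0%N) (y j) < height (x 0%N) (y i) by rewrite lt_neqAle eq_sym n2.
    have km2 : (m.+1 + k < m.*2.+2)%N by clear -km; lia.
    rewrite lt_height_affine ?posx ?posy // in l1.
    rewrite lt_height_affine ?posx ?posy //.
    rewrite gt_height_affine ?posx ?posy // in l2.
    apply: (affine_beyond l1 l2); apply: xle; rewrite ?yY //; clear -km; lia.
exists (take m.+1 (drop off xs)), ys.
have subz : {subset take m.+1 (drop off xs) <= xs}.
  by move=> u /mem_take /mem_drop.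
split=> //.
- split=> //; apply: take_uniq; apply: drop_uniq.
  have [y1 y1Y] : exists y1, y1 \in Y by apply/card_gt0P; lia.
  by apply: pairwise_uniq (dec _ y1Y) => u; rewrite ltxx.
- by rewrite size_takel // size_drop sz; lia.
move=> z0 y0 i j /andP[ij jm]; have im := ltn_trans ij jm.
rewrite !nth_take // !nth_drop.
rewrite !(set_nth_default x0) ?sz ?szy //; try by clear -ij jm im offm; lia.
rewrite -/(x _) -/(x _) -/(y i) -/(y j).
split; [apply: xdec|apply: xdec|apply: inc|apply: inc]; rewrite ?yY //; clear -ij jm im offm; lia.
Qed.

(* The points of [X] cross the horizontal line of height [t] between the
   points of [Y1] and those of [Y2]. *)
Lemma wedge_grid A X Y1 Y2 m t :
    pos A (Y1 :|: Y2) -> nondegenerate A (Y1 :|: Y2) -> X \subset A ->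
    {in X & Y1, forall x y, height x y < t} -> {in X & Y2, forall x y, t < height x y} ->
    (m.*2.+1 * m.*2.+1 < #|X|)%N -> (m * m < #|Y1|)%N -> (m * m < #|Y2|)%N ->
  exists zs ys : seq I, [/\ {subset zs <= A} /\ uniq zs,
    {subset ys <= Y1 :|: Y2} /\ uniq ys,
    size zs = m.+1, size ys = m.+1 &
    forall z0 y0 i j, (i < j < m.+1)%N ->
      height_cross (nth z0 zs i) (nth y0 ys i) (nth z0 zs j) (nth y0 ys j)].
Proof.
move=> pAY [ndl ndr] sXA lt1 lt2 cX c1 c2.
pose f x := t * alpha x - beta x.
have xA x : x \in X -> x \in A by move/(subsetP sXA).
have posx x : x \in X -> 0 < alpha x by move/xA => /(posl pAY).
have y1Y y : y \in Y1 -> y \in Y1 :|: Y2 by rewrite inE => ->.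
have y2Y y : y \in Y2 -> y \in Y1 :|: Y2 by rewrite inE orbC => ->.
have posy y : y \in Y1 :|: Y2 -> 0 < alpha y by move/(posr pAY).
(* As [f] grows along the chain, the heights do not increase at points of [Y2] if [alpha] grows too,
   nor at points of [Y1] if [alpha] decreases; this is [mono] below. Either kind of chain has the
   2m+2 elements that [chain_grid] takes. *)
have [|//|xs [szx sxs uxs chx]] := @erdos_szekeres _ _ f alpha X m.*2.+1.
  move=> x x' xX x'X ef ea; have /card_gt0P[y yY1] : (0 < #|Y1|)%N by lia.
  apply: (ndr y); rewrite ?xA ?y1Y //.
  have eb : beta x = beta x' by move: ef; rewrite /f ea => /addrI /oppr_inj.
  by rewrite /height ea eb.
have sxA : {subset xs <= A} by move=> x /sxs /xA.
have grid Y : (forall y, y \in Y -> y \in Y1 :|: Y2) -> (m * m < #|Y|)%N ->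
    pairwise (fun x x' => [forall y in Y, height x' y <= height x y]) xs ->
  exists zs ys : seq I, [/\ {subset zs <= A} /\ uniq zs,
    {subset ys <= Y1 :|: Y2} /\ uniq ys, size zs = m.+1, size ys = m.+1 &
    forall z0 y0 i j, (i < j < m.+1)%N ->
      height_cross (nth z0 zs i) (nth y0 ys i) (nth z0 zs j) (nth y0 ys j)].
  move=> sY cY pw.
  have pAY' : pos A Y by move=> u; rewrite inE => /orP[/(posl pAY)|/sY /(posr pAY)].
  have ndAY : nondegenerate A Y.
    by split=> [a b b' aA /sY bY /sY b'Y|b a a' /sY bY]; [apply: ndl|apply: ndr].
  have dec y : y \in Y -> pairwise (fun x x' => height x' y < height x y) xs.
    move=> yY; have := uxs; rewrite uniq_pairwise => ux.
    have := conj pw ux => /andP; rewrite -pairwise_relI.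
    have axs : all (mem xs) xs by apply/allP.
    apply: (@sub_in_pairwise _ (mem xs)) axs => x x' xxs x'xs /andP[/forall_inP/(_ y yY)].
    rewrite le_eqVlt => /orP[/eqP e /eqP []|//].
    by apply: (ndr y); rewrite ?sY ?sxA.
  have [zs [ys [[sz uz] [sy uy] cz cy cr]]] := chain_grid pAY' ndAY sxA dec szx cY.
  by exists zs, ys; split=> //; split=> // u; [move/sz/sxA|move/sy/sY].
have mono x x' y : x \in xs -> x' \in xs -> y \in Y1 :|: Y2 -> f x <= f x' ->
    0 <= (t - height x' y) * (alpha x - alpha x') -> height x' y <= height x y.
  move=> /sxs xX /sxs x'X yY; rewrite /f => lef le.
  rewrite {2}/height ler_pdivlMr; last by apply: addr_gt0; [apply: posx|apply: posy].
  by have := height_eq (posx _ x'X) (posy _ yY); set S := height x' y in le * => e; nra.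
have axs : all (mem xs) xs by apply/allP.
case: chx => chx; [apply: grid y2Y c2 _ | apply: grid y1Y c1 _];
  apply: (@sub_in_pairwise _ (mem xs) _ _ _ xs axs chx) => x x' xxs x'xs /andP[lef lea];
  apply/forall_inP => y yY; (apply: mono => //; first by rewrite inE yY ?orbT).
- by rewrite mulr_le0 // subr_le0 // ltW // lt2 // sxs.
- by rewrite mulr_ge0 // subr_ge0 // ltW // lt1 // sxs.
Qed.

(** The points of [B] seen from a below the median [t] form a nested family as [f a] grows, and so
    do those seen above. Hence a point with extremal [f] provides a set common to many a. *)
Lemma planar_grid A B m q :
    pos A B -> nondegenerate A B -> #|A| = (8 * q)%N -> #|B| = (8 * q)%N ->
    (m.*2.+1 * m.*2.+1 < q)%N ->
  exists zs ys : seq I, [/\ {subset zs <= A} /\ uniq zs, {subset ys <= B} /\ uniq ys,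
    size zs = m.+1, size ys = m.+1 &
    forall z0 y0 i j, (i < j < m.+1)%N ->
      height_cross (nth z0 zs i) (nth y0 ys i) (nth z0 zs j) (nth y0 ys j) \/
      height_cross (nth y0 ys i) (nth z0 zs i) (nth y0 ys j) (nth z0 zs j)].
Proof.
move=> pAB ndAB cA cB mq; have [ndl ndr] := ndAB.
have q0 : (0 < q)%N by apply: leq_ltn_trans mq.
have mq' : (m * m < q)%N by apply: leq_ltn_trans mq; rewrite -addnn; nia.
have posa := posl pAB; have posb := posr pAB.
have [|t [med1 med2]] := @median _ _ (setX A B) (fun p => height p.1 p.2).
  by rewrite cardsX cA cB muln_gt0 !muln_gt0 q0.
rewrite (@card_setX_set _ _ A B (fun a b => height a b < t)%R) in med1.
rewrite (@card_setX_set _ _ A B (fun a b => t < height a b)%R) in med2.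
rewrite cardsX cA cB in med1 med2.
pose f a := t * alpha a - beta a; pose g b := beta b - t * alpha b.
have ltE a b : a \in A -> b \in B -> (height a b < t) = (g b < f a).
  by move=> /posa a0 /posb b0; rewrite heightE' // subr_lt0.
have gtE a b : a \in A -> b \in B -> (t < height a b) = (f a < g b).
  by move=> /posa a0 /posb b0; rewrite heightE // subr_gt0.
pose L a := [set b in B | height a b < t]; pose U a := [set b in B | t < height a b].
(* The 1 accounts for the only point of [B] that can be seen exactly at height [t]. *)
have LU a : a \in A -> (8 * q <= #|L a| + #|U a| + 1)%N.
  move=> aA; rewrite -cB; pose E := [set b in B | height a b == t].
  have cE : (#|E| <= 1)%N.
    apply/card_le1_eqP => b b' /setIdP[bB /eqP e] /setIdP[b'B /eqP e'].
    by apply: (ndl a); rewrite ?e.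
  have sB : B \subset L a :|: U a :|: E.
    by apply/subsetP => b bB; rewrite !inE bB /=; case: ltgtP.
  apply: leq_trans (subset_leq_card sB) _.
  apply: leq_trans (leq_card_setU _ _) _; apply: leq_add => //.
  exact: leq_card_setU.
have Lmono a a' b : a \in A -> a' \in A -> f a <= f a' -> b \in L a -> b \in L a'.
  move=> aA a'A le /setIdP[bB]; rewrite ltE // inE bB ltE //=.
  by move=> lt; apply: lt_le_trans le.
have Umono a a' b : a \in A -> a' \in A -> f a' <= f a -> b \in U a -> b \in U a'.
  move=> aA a'A le /setIdP[bB]; rewrite gtE // inE bB gtE //=.
  by apply: le_lt_trans.
pose A1 := [set a in A | (#|L a| < q)%N]; pose A2 := [set a in A | (#|U a| < q)%N].
pose A0 := [set a in A | (q <= #|L a|)%N && (q <= #|U a|)%N].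
have sA1 : A1 \subset A by apply/subsetP => a /setIdP[].
have sA2 : A2 \subset A by apply/subsetP => a /setIdP[].
have sA0 : A0 \subset A by apply/subsetP => a /setIdP[].
have cA012 : (8 * q <= #|A0| + #|A1| + #|A2|)%N.
  have sA : A \subset A0 :|: A1 :|: A2.
    apply/subsetP => a aA; rewrite !inE aA /=.
    by case: leqP => //= _; case: leqP => //= _; rewrite ?orbT.
  rewrite -cA; apply: leq_trans (subset_leq_card sA) _.
  apply: leq_trans (leq_card_setU _ _) _; rewrite leq_add2r.
  exact: leq_card_setU.
(* More than 6q points with 7q pairs each would give over 42 q^2 pairs on one side of the median,
   which allows 32 q^2. *)
have fewA (Z : {set I}) (W : I -> {set I}) : Z \subset A ->
    (2 * (\sum_(a in A) #|W a|) <= (8 * q) * (8 * q))%N ->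
    (forall a, a \in Z -> 7 * q <= #|W a|)%N -> (6 * q < #|Z|)%N -> False.
  move=> sZ le big cZ.
  have : (\sum_(a in Z) 7 * q <= \sum_(a in A) #|W a|)%N.
    rewrite [in leqRHS](big_setID Z) /= (setIidPr sZ).
    by apply: leq_trans (leq_addr _ _); apply: leq_sum.
  rewrite sum_nat_const; clear -q0 le cZ; nia.
have [big0|small0] := leqP q #|A0|.
  have /card_gt0P[a0 a0A] : (0 < #|A0|)%N by apply: leq_trans big0.
  have [al alA minl] := arg_minP f a0A; have [au auA maxu] := arg_maxP f a0A.
  have /setIdP[alA' /andP[cl _]] : al \in A0 := alA.
  have /setIdP[auA' /andP[_ cu]] : au \in A0 := auA.
  have sLU : L al :|: U au \subset B.
    by rewrite subUset; apply/andP; split; apply/subsetP => b /setIdP[].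
  have posLU : pos A (L al :|: U au).
    by move=> u; rewrite in_setU => /orP[/posa|/(subsetP sLU)/posb].
  have ndLU : nondegenerate A (L al :|: U au).
    by split=> [a b b' aA /(subsetP sLU) bB /(subsetP sLU) b'B|b a a' /(subsetP sLU) bB];
      [apply: ndl|apply: ndr].
  have [|||||zs [ys [[sz uz] [sy uy] cz cy cr]]] := wedge_grid (t := t) (m := m) posLU ndLU sA0.
  - move=> a b aA0 bL; have aA := subsetP sA0 a aA0.
    by have /setIdP[] := Lmono al a b alA' aA (minl a aA0) bL.
  - move=> a b aA0 bU; have aA := subsetP sA0 a aA0.
    by have /setIdP[] := Umono au a b auA' aA (maxu a aA0) bU.
  - by apply: leq_trans big0.
  - by apply: leq_trans cl.
  - by apply: leq_trans cu.
  exists zs, ys; split=> //; first by split=> // u /sy; apply: subsetP.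
  by move=> z0 y0 i j ij; left; apply: cr.
have [small1|big1] := ltnP #|A1| q.
  exfalso; apply: (fewA A2 L sA2 med1).
    by move=> a /setIdP[aA cU]; have := LU a aA; clear -cU; lia.
  clear -small0 small1 cA012; lia.
have [small2|big2] := ltnP #|A2| q.
  exfalso; apply: (fewA A1 U sA1 med2).
    by move=> a /setIdP[aA cU]; have := LU a aA; clear -cU; lia.
  clear -small0 small2 cA012; lia.
have /card_gt0P[a1 a1A] : (0 < #|A1|)%N by apply: leq_trans big1.
have /card_gt0P[a2 a2A] : (0 < #|A2|)%N by apply: leq_trans big2.
have [al alA maxl] := arg_maxP f a1A; have [au auA minu] := arg_minP f a2A.
have /setIdP[alA' cl] : al \in A1 := alA.
have /setIdP[auA' cu] : au \in A2 := auA.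
(* From every point of [X], all of [A2] is seen below [t] and all of [A1] above it: the two sides
   have exchanged roles. *)
pose X := U al :&: L au.
have sXB : X \subset B by apply/subsetP => b /setIP[/setIdP[]].
have cX : (q <= #|X|)%N.
  have sUL : U al :|: L au \subset B.
    by rewrite subUset; apply/andP; split; apply/subsetP => b /setIdP[].
  have := cardsUI (U al) (L au); rewrite -/X.
  have := subset_leq_card sUL; rewrite cB.
  have := LU al alA'; have := LU au auA'; clear -cl cu q0.
  by move: #|_ :|: _| #|X| #|L al| #|U al| #|L au| #|U au| cl cu => *; lia.
have sA12 : A2 :|: A1 \subset A by rewrite subUset sA1 sA2.
have posBA : pos B (A2 :|: A1).
  by move=> u; rewrite in_setU => /orP[/posb|/(subsetP sA12)/posa].
have ndBA : nondegenerate B (A2 :|: A1).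
  split=> [b a a' bB /(subsetP sA12) aA /(subsetP sA12) a'A|a b b' /(subsetP sA12) aA bB b'B].
    by rewrite !(heightC b); apply: ndr.
  by rewrite !(heightC _ a); apply: ndl.
have [|||||zs [ys [[sz uz] [sy uy] cz cy cr]]] := wedge_grid (t := t) (m := m) posBA ndBA sXB.
- move=> b a /setIP[_ bL] aA2; have aA := subsetP sA2 a aA2; rewrite heightC.
  by have /setIdP[] := Lmono au a b auA' aA (minu a aA2) bL.
- move=> b a /setIP[bU _] aA1; have aA := subsetP sA1 a aA1; rewrite heightC.
  by have /setIdP[] := Umono al a b alA' aA (maxl a aA1) bU.
- by apply: leq_trans cX.
- by apply: leq_trans big2.
- by apply: leq_trans big1.
exists ys, zs; split=> //; first by split=> // u /sy; apply: subsetP.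
by move=> z0 y0 i j ij; right; apply: cr.
Qed.

End Planar.

(** * Separation by a hyperplane, and crossing segments in the plane *)

Lemma split_by (R : realFieldType) (I : finType) (r : I -> R) (S : {set I}) n :
    {in S &, injective r} -> (n <= #|S|)%N ->
  exists A : {set I}, [/\ A \subset S, #|A| = n &
    {in A & S :\: A, forall a b, r a < r b}].
Proof.
move=> inj; elim: n => [|n IH] cS.
  by exists set0; split; rewrite ?sub0set ?cards0 // => a b; rewrite inE.
have [A [sA cA lt]] := IH (ltnW cS).
have /card_gt0P[x0 x0SA] : (0 < #|S :\: A|)%N.
  by rewrite cardsD (setIidPr sA) cA subn_gt0.
have [x xSA minx] := arg_minP r x0SA.
have /setDP[xS xA] : x \in S :\: A := xSA.
exists (x |: A); split; first by rewrite subUset sub1set xS.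
  by rewrite cardsU1 xA cA.
move=> a b aA; rewrite !inE negb_or -andbA => /and3P[bx bA bS].
have bSA : b \in S :\: A by rewrite inE bA.
move: aA; rewrite !inE => /orP[/eqP ->|aA]; last exact: lt.
rewrite lt_neqAle minx // andbT; apply: contra bx => /eqP /inj -> //.
Qed.

(** The vectors are read as coefficient lists of polynomials. The form is evaluation at a number t
    that is a root of none of them, found among more integers than their product has roots. *)
Lemma generic_form (R : realFieldType) (D : nat) (I : finType) (U : {set I})
    (y : I -> 'rV[R]_D) : (forall u, u \in U -> y u != 0) ->
  exists h, forall u, u \in U -> pairing h (y u) != 0.
Proof.
move=> y0; pose p := \prod_(u in U) rVpoly (y u).
have p0 : p != 0.
  apply/prodf_neq0 => u uU; apply: contra (y0 u uU) => /eqP e.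
  by rewrite -[y u]rVpolyK e linear0.
pose rs := [seq i%:R : R | i <- iota 0 (size p)].
have urs : uniq rs by rewrite map_inj_uniq ?iota_uniq //; apply: mulrIn; rewrite ?oner_eq0.
have /allPn[t _ rt] : ~~ all (root p) rs.
  by apply/negP => /(max_poly_roots p0)/(_ urs); rewrite size_map size_iota ltnn.
exists (\col_i t ^+ i) => u uU.
have : (rVpoly (y u)).[t] != 0.
  apply: contra rt; rewrite /p (bigD1 u) //= rootM => /eqP e.
  by rewrite /root e eqxx.
suff -> : (rVpoly (y u)).[t] = pairing (\col_i t ^+ i) (y u) by [].
rewrite horner_poly /pairing mxE; apply: eq_bigr => i _.
by rewrite mxE /= insubT //= => lti; congr (y u _ _ * _); apply: val_inj.
Qed.

Section Configurations.
Context {R : realFieldType} {I : finType}.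

(** All vectors lie in an open half-space. This replaces the first coordinate 1 of lifted points,
    which a projection does not preserve. *)
Definition pointed D (v : I -> 'rV[R]_D) (S : {set I}) :=
  exists l, forall u, u \in S -> 0 < pairing l (v u).

(** [E] is the dimension before lifting, hence the number of vertices of a simplex. *)
Definition crossing_system E (v : I -> 'rV[R]_E.+1) (S : {set I}) (m : nat) :=
  exists2 F : 'I_m -> {set I}, (forall i, F i \subset S /\ #|F i| = E) &
    forall i j, i != j -> [disjoint F i & F j] /\ cone_cross v (F i) (F j).

(** The points are sorted by the affine coordinate lam / l, where [lam] is generic so that no two
    values agree; [A] takes the smallest ones. The last inequality compares these quotients with
    denominators cleared. *)
Lemma separated_subsets E (v : I -> 'rV[R]_E.+2) (S : {set I}) l n k :
    general v S -> (forall u, u \in S -> 0 < pairing l (v u)) ->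
    (E.+2 <= #|S|)%N -> (n + k <= #|S|)%N ->
  exists (A B : {set I}) lam, [/\ A \subset S /\ #|A| = n, B \subset S /\ #|B| = k,
    [disjoint A & B] & {in A & B, forall a b,
      pairing lam (v a) * pairing l (v b) < pairing lam (v b) * pairing l (v a)}].
Proof.
move=> gS lpos cS cnk.
pose x (p : I * I) := pairing l (v p.2) *: v p.1 - pairing l (v p.1) *: v p.2.
pose U := [set p in setX S S | p.1 != p.2].
have [|lam hlam] := @generic_form R E.+2 _ U x.
  move=> [u u']; rewrite !inE /= => /andP[/andP[uS u'S] neq].
  have ind : independent v [set u; u'].
    apply: general_independent gS _ _ cS; first by rewrite subUset !sub1set uS.
    by rewrite cards2 neq.
  apply/eqP => e; have := ind (fun t => if t == u then pairing l (v u') else - pairing l (v u)).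
  rewrite big_setU1 ?inE //= big_set1 eqxx eq_sym (negbTE neq) scaleNr -/(x (u, u')).
  move=> /(_ e u); rewrite !inE eqxx /= => /(_ isT) /eqP.
  by rewrite gt_eqF // lpos.
pose r u := pairing lam (v u) / pairing l (v u).
have rinj : {in S &, injective r}.
  move=> u u' uS u'S e; apply/eqP; apply: contraT => neq.
  have := hlam (u, u'); rewrite !inE /= uS u'S neq => /(_ isT).
  rewrite /x /= pairingB !pairingZ; move: e; rewrite /r.
  have lu : pairing l (v u) != 0 by rewrite gt_eqF ?lpos.
  have lu' : pairing l (v u') != 0 by rewrite gt_eqF ?lpos.
  move=> /eqP; rewrite eqr_div // => /eqP e.
  by rewrite mulrC e mulrC subrr eqxx.
have [A [sA cA lt]] := split_by rinj (leq_trans (leq_addr k n) cnk).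
have [|B sB cB] := @subset_card _ (S :\: A) k.
  by rewrite cardsD (setIidPr sA) cA leq_subRL // (leq_trans _ cnk) // leq_addr.
exists A, B, lam; split=> //.
- by split=> //; apply: subset_trans sB (subsetDl _ _).
- by rewrite disjoint_sym; move: sB; rewrite subsetD => /andP[].
- move=> a b aA bB; have bSA := subsetP sB b bB.
  have /setDP[bS _] := bSA; have aS := subsetP sA a aA.
  have := lt a b aA bSA; rewrite /r ltr_pdivrMr ?lpos // mulrAC ltr_pdivlMr ?lpos //.
Qed.

End Configurations.

Section PlaneBase.
Context {R : realFieldType} {I : finType} (v : I -> 'rV[R]_3).

(** As [lam] changes sign while [l] stays positive, the two forms are independent. A nonzero vector
    orthogonal to both completes them to coordinates, since its product with itself is not 0. *)
Lemma complementary_form (lam l : 'cV[R]_3) (x y : 'rV[R]_3) :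
    pairing lam x < 0 -> 0 < pairing lam y -> 0 < pairing l x -> 0 < pairing l y ->
  exists mu, (forall z, pairing lam z = 0 -> pairing l z = 0 -> pairing mu z = 0 -> z = 0)
    /\ exists z, [/\ pairing lam z = 0, pairing l z = 0 & pairing mu z != 0].
Proof.
move=> lx ly px py; pose f2 (b : bool) := if b then lam^T else l^T.
have [|h h0 hf] := @vanishing_form R 3 _ f2 [set: bool].
  by rewrite cardsT card_bool.
have tr (p q : 'cV[R]_3) : pairing p q^T = \sum_i q i 0 * p i 0.
  by rewrite /pairing mxE; apply: eq_bigr => i _; rewrite mxE.
have trC (p q : 'cV[R]_3) : pairing p q^T = pairing q p^T.
  by rewrite !tr; apply: eq_bigr => i _; rewrite mulrC.
have hlam : pairing h lam^T = 0 by apply: (hf true); rewrite inE.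
have hl : pairing h l^T = 0 by apply: (hf false); rewrite inE.
have hh : pairing h h^T != 0.
  rewrite tr psumr_eq0 => [|i _]; last by rewrite -expr2 sqr_ge0.
  apply: contra h0 => /allP hi; apply/eqP/colP => i; rewrite mxE.
  by have := hi i (mem_index_enum _); rewrite /= mulf_eq0 orbb => /eqP.
pose f3 (i : 'I_3) := tnth [tuple lam^T; l^T; h^T] i.
have ind : independent f3 [set: 'I_3].
  move=> w; rewrite (eq_bigl xpredT) => [|i]; last by rewrite inE.
  rewrite !big_ord_recl big_ord0 addr0 /f3 !(tnth_nth 0) /=.
  set w0 := w _; set w1 := w _; set w2 := w _ => e.
  have e2 : w2 = 0.
    have := congr1 (pairing h) e; rewrite !pairingD !pairingZ hlam hl !mulr0 !add0r pairing0.
    by move/eqP; rewrite mulf_eq0 (negbTE hh) orbF => /eqP.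
  have ev z : w0 * pairing lam z + w1 * pairing l z = 0.
    have := congr1 (fun q : 'rV_3 => pairing q^T z) e.
    rewrite /= e2 scale0r addr0 !linearD !linearZ /= !trmxK trmx0.
    rewrite /pairing mulmxDr mulmx0 -!scalemxAr !mxE => ->; lra.
  have ex := ev x; have ey := ev y.
  have e1 : w1 = 0.
    have : w1 * (pairing l x * pairing lam y - pairing l y * pairing lam x) = 0.
      have -> : w1 * (pairing l x * pairing lam y - pairing l y * pairing lam x) =
        (w0 * pairing lam x + w1 * pairing l x) * pairing lam y -
        (w0 * pairing lam y + w1 * pairing l y) * pairing lam x by ring.
      by rewrite ex ey !mul0r subrr.
    move/eqP; rewrite mulf_eq0 => /orP[/eqP //|/eqP].
    by have := mulr_gt0 px ly; have := mulr_gt0 py (_ : 0 < - pairing lam x); nra.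
  have e0 : w0 = 0.
    move: ey; rewrite e1 mul0r addr0 => /eqP; rewrite mulf_eq0.
    by rewrite (gt_eqF ly) orbF => /eqP.
  move=> i _; case: i => [[|[|[|//]]] hi]; [rewrite -e0|rewrite -e1|rewrite -e2];
    congr w; exact: val_inj.
exists h; split; last by exists h^T; rewrite !(trC _ h).
move=> z z1 z2 z3; apply: trmx_inj; rewrite trmx0.
apply: (form_eq0 ind); first by rewrite cardsT card_ord.
move=> i _; rewrite /f3 (tnth_nth 0).
by case: i => [[|[|[|//]]] hi] /=; rewrite trC trmxK.
Qed.

(* The coefficients are the minors in Cramer's rule. *)
Lemma height_cross_cone (lam l mu : 'cV[R]_3) (theta alpha beta : I -> R) (sg : R) a b a' b' :
    (forall z, pairing lam z = 0 -> pairing l z = 0 -> pairing mu z = 0 -> z = 0) ->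
    uniq [:: a; b; a'; b'] ->
    (forall u, u \in [:: a; b; a'; b'] -> [/\ 0 < theta u, 0 < alpha u,
       pairing l (v u) = theta u * alpha u & pairing mu (v u) = theta u * beta u]) ->
    pairing lam (v a) = - sg * theta a -> pairing lam (v a') = - sg * theta a' ->
    pairing lam (v b) = sg * theta b -> pairing lam (v b') = sg * theta b' ->
    height_cross alpha beta a b a' b' ->
  cone_cross v [set a; b] [set a'; b'].
Proof.
move=> inj un hu la la' lb lb' [h1 h2 h3 h4].
have [ta aa pa qa] := hu a (mem_head _ _).
have [|tb ab pb qb] := hu b; first by rewrite !inE eqxx orbT.
have [|ta' aa' pa' qa'] := hu a'; first by rewrite !inE eqxx !orbT.
have [|tb' ab' pb' qb'] := hu b'; first by rewrite !inE eqxx !orbT.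
have hlt x y z t : 0 < alpha x -> 0 < alpha y -> 0 < alpha z -> 0 < alpha t ->
    height alpha beta x y < height alpha beta z t ->
    0 < (beta z + beta t) * (alpha x + alpha y) - (beta x + beta y) * (alpha z + alpha t).
  move=> x0 y0 z0 t0; have xy := addr_gt0 x0 y0; have zt := addr_gt0 z0 t0.
  by rewrite /height ltr_pdivrMr // mulrAC ltr_pdivlMr // subr_gt0.
move: un; rewrite /= !inE !negb_or => /and4P[/and3P[nab naa' nab'] /andP[nba' nbb'] na'b' _].
pose ca := (beta a' + beta b') * (alpha a' + alpha b) - (beta a' + beta b) * (alpha a' + alpha b').
pose ca' := (beta a + beta b') * (alpha a + alpha b) - (beta a + beta b) * (alpha a + alpha b').
pose cb := (beta a + beta b') * (alpha a' + alpha b') - (beta a' + beta b') * (alpha a + alpha b').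
pose cb' := (beta a + beta b) * (alpha a' + alpha b) - (beta a' + beta b) * (alpha a + alpha b).
have ca0 : 0 < ca by apply: hlt h4.
have ca'0 : 0 < ca' by apply: hlt h3.
have cb0 : 0 < cb by apply: hlt h2.
have cb'0 : 0 < cb' by apply: hlt h1.
pose w u := if u == a then ca / theta a else if u == b then cb / theta b else
  if u == a' then ca' / theta a' else cb' / theta b'.
exists w; first by move=> u _; rewrite /w; do 3?case: ifP => _; rewrite divr_gt0.
rewrite !big_setU1 ?inE //= !big_set1 /w !eqxx.
rewrite [b == a]eq_sym (negbTE nab) [a' == a]eq_sym (negbTE naa') [a' == b]eq_sym (negbTE nba').
rewrite [b' == a]eq_sym (negbTE nab') [b' == b]eq_sym (negbTE nbb').
rewrite [b' == a']eq_sym (negbTE na'b').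
apply/eqP; rewrite -subr_eq0; apply/eqP.
have canc (c t X : R) : 0 < t -> c / t * (X * t) = c * X.
  by move=> t0; rewrite mulrACA mulVf ?gt_eqF // mulr1.
apply: inj; rewrite pairingB !pairingD !pairingZ.
- by rewrite la lb la' lb' !canc // /ca /ca' /cb /cb'; ring.
- rewrite pa pb pa' pb' !(mulrC (theta _)) !canc // /ca /ca' /cb /cb'; ring.
- rewrite qa qb qa' qb' !(mulrC (theta _)) !canc // /ca /ca' /cb /cb'; ring.
Qed.

Lemma plane_crossing_system (S : {set I}) m :
    general v S -> pointed v S -> (64 * m ^ 2 <= #|S|)%N ->
  crossing_system v S m.
Proof.
case: m => [|m] gS [l lpos] cS; first by exists (fun=> set0); case.
(* The construction uses 8q points on either side, and 16q is the available 64 (m+1)^2. *)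
set q := (4 * m.+1 ^ 2)%N; have mq : (m.*2.+1 * m.*2.+1 < q)%N by rewrite /q -muln2; nia.
have q0 : (0 < q)%N by apply: leq_ltn_trans mq.
have cSq : (16 * q <= #|S|)%N by apply: leq_trans cS; rewrite /q mulnA.
have c3 : (3 <= #|S|)%N by apply: leq_trans cSq; lia.
have [|A [B [lam0 [[sA cA] [sB cB] dAB sep]]]] :=
  @separated_subsets R I 1 v S l (8 * q)%N (8 * q)%N gS lpos c3.
  by apply: leq_trans cSq; lia.
have aS a : a \in A -> a \in S by apply: (subsetP sA).
have bS b : b \in B -> b \in S by apply: (subsetP sB).
have /card_gt0P[a0 a0A] : (0 < #|A|)%N by rewrite cA; lia.
have /card_gt0P[b0 b0B] : (0 < #|B|)%N by rewrite cB; lia.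
pose r u := pairing lam0 (v u) / pairing l (v u).
have [am amA maxa] := arg_maxP r a0A; have [bm bmB minb] := arg_minP r b0B.
have rlt a b : a \in A -> b \in B -> r a < r b.
  move=> aA bB; rewrite /r ltr_pdivrMr ?lpos ?aS // mulrAC ltr_pdivlMr ?lpos ?bS //.
  exact: sep.
(* [c] lies strictly between the ratios on [A] and those on [B], so [lam] is negative on [A] and
   positive on [B]. *)
pose c := (r am + r bm) / 2; pose lam := lam0 - c *: l.
have rab := rlt am bm amA bmB.
have lamE u : u \in S -> pairing lam (v u) = (r u - c) * pairing l (v u).
  by move=> uS; rewrite pairingBl pairingZl mulrBl /r divfK // gt_eqF ?lpos.
have lamA a : a \in A -> pairing lam (v a) < 0.
  move=> aA; rewrite lamE ?aS // pmulr_llt0 ?lpos ?aS // subr_lt0.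
  by apply: le_lt_trans (maxa a aA) _; rewrite /c; lra.
have lamB b : b \in B -> 0 < pairing lam (v b).
  move=> bB; rewrite lamE ?bS // pmulr_lgt0 ?lpos ?bS // subr_gt0.
  by apply: lt_le_trans (minb b bB); rewrite /c; lra.
have [mu [inj [z0 [lz0 pz0 mz0]]]] := complementary_form (lamA a0 a0A) (lamB b0 b0B)
  (lpos a0 (aS a0 a0A)) (lpos b0 (bS b0 b0B)).
pose theta u := `|pairing lam (v u)|.
pose alpha u := pairing l (v u) / theta u; pose beta u := pairing mu (v u) / theta u.
have thA a : a \in A -> pairing lam (v a) = - theta a.
  by move=> aA; rewrite /theta ltr0_norm ?opprK ?lamA.
have thB b : b \in B -> pairing lam (v b) = theta b.
  by move=> bB; rewrite /theta gtr0_norm ?lamB.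
have thpos u : u \in A :|: B -> 0 < theta u.
  by rewrite in_setU normr_gt0 => /orP[/lamA|/lamB]; [move/lt_eqF|move/gt_eqF] => ->.
have ABS u : u \in A :|: B -> u \in S by rewrite in_setU => /orP[/aS|/bS].
have alE u : u \in A :|: B -> [/\ 0 < theta u, 0 < alpha u,
    pairing l (v u) = theta u * alpha u & pairing mu (v u) = theta u * beta u].
  move=> uAB; have t0 := thpos u uAB; rewrite /alpha /beta divr_gt0 ?lpos ?ABS //.
  by split=> //; rewrite mulrC divfK // gt_eqF.
have apos u : u \in A :|: B -> 0 < alpha u by case/alE.
have inA u : u \in A -> u \in A :|: B by rewrite inE => ->.
have inB u : u \in B -> u \in A :|: B by rewrite inE orbC => ->.
have heightE a b : a \in A -> b \in B ->
    beta a + beta b = height alpha beta a b * (alpha a + alpha b).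
  move=> aA bB; rewrite /height divfK // gt_eqF //.
  by apply: addr_gt0; [apply/apos/inA|apply/apos/inB].
(* By general position the three points would make [mu] a combination of [l] and [lam] everywhere,
   but [mu] is nonzero at the common zero [z0] of these forms. *)
have collinear x y z h k : uniq [:: x; y; z] -> x \in S -> y \in S -> z \in S ->
    (forall u, u \in [:: x; y; z] ->
       pairing mu (v u) = h * pairing l (v u) + k * pairing lam (v u)) -> False.
  move=> un xS yS zS e; have c3' : #|[set x; y; z]| = 3%N.
    move: un; rewrite /= !inE negb_or => /andP[/andP[xy xz] /andP[yz _]].
    by rewrite -setUA cardsU1 cards2 !inE negb_or xy xz yz.
  have sS : [set x; y; z] \subset S by rewrite !subUset !sub1set xS yS zS.
  have phi0 : mu - h *: l - k *: lam = 0.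
    apply: (form_eq0 (gS _ sS c3') c3') => u; rewrite !inE -orbA => uxyz.
    by rewrite !pairingBl !pairingZl e ?inE //; ring.
  move: mz0; rewrite -[mu](subrK (h *: l)) -[mu - _](subrK (k *: lam)) phi0 add0r.
  by rewrite -[h *: l]opprK pairingBl -scaleNr !pairingZl lz0 pz0 !mulr0 subr0 eqxx.
have dab a b : a \in A -> b \in B -> a != b.
  by move=> aA bB; apply: contraTneq aA => ->; rewrite (disjointFl dAB bB).
have onA h k a : a \in A -> beta a = h * alpha a - k ->
    pairing mu (v a) = h * pairing l (v a) + k * pairing lam (v a).
  move=> aA e; have [_ _ -> ->] := alE a (inA a aA); rewrite thA // e; ring.
have onB h k b : b \in B -> beta b = h * alpha b + k ->
    pairing mu (v b) = h * pairing l (v b) + k * pairing lam (v b).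
  move=> bB e; have [_ _ -> ->] := alE b (inB b bB); rewrite thB // e; ring.
have nd : nondegenerate alpha beta A B.
  split=> [a b b' aA bB b'B e|b a a' bB aA a'A e]; apply/eqP; apply: contraT => neq; exfalso.
    have e1 := heightE a b aA bB; have e2 := heightE a b' aA b'B; rewrite -e in e2.
    set h := height _ _ _ _ in e1 e2; pose k := h * alpha a - beta a.
    apply: (@collinear a b b' h k); [|exact: aS|exact: bS|exact: bS|].
      by rewrite /= !inE negb_or (dab a b) // (dab a b') // neq.
    move=> u; rewrite !inE => /or3P[]/eqP ->; [apply: onA|apply: onB|apply: onB] => //;
      by clear -e1 e2; rewrite /k; lra.
  have e1 := heightE a b aA bB; have e2 := heightE a' b a'A bB; rewrite -e in e2.
  set h := height _ _ _ _ in e1 e2; pose k := beta b - h * alpha b.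
  apply: (@collinear a a' b h k); [|exact: aS|exact: aS|exact: bS|].
    by rewrite /= !inE negb_or (dab a b) // (dab a' b) // neq.
  move=> u; rewrite !inE => /or3P[]/eqP ->; [apply: onA|apply: onA|apply: onB] => //;
    by clear -e1 e2; rewrite /k; lra.
have [zs [ys [[sz uz] [sy uy] cz cy cross]]] := planar_grid apos nd cA cB mq.
pose z i := nth a0 zs i; pose y i := nth a0 ys i.
have zA i : (i < m.+1)%N -> z i \in A by move=> ?; apply: sz; rewrite mem_nth ?cz.
have yB i : (i < m.+1)%N -> y i \in B by move=> ?; apply: sy; rewrite mem_nth ?cy.
exists (fun i : 'I_m.+1 => [set z i; y i]).
  move=> i; rewrite subUset !sub1set aS ?bS ?zA ?yB //.
  by rewrite cards2 dab ?zA ?yB.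
have main (i j : 'I_m.+1) : (i < j)%N ->
  [disjoint [set z i; y i] & [set z j; y j]] /\ cone_cross v [set z i; y i] [set z j; y j].
  move=> ij; have zz : z i != z j by rewrite nth_uniq ?cz // ltn_eqF.
  have yy : y i != y j by rewrite nth_uniq ?cy // ltn_eqF.
  have zy i' j' : (i' < m.+1)%N -> (j' < m.+1)%N -> z i' != y j'.
    by move=> ? ?; rewrite dab ?zA ?yB.
  have yz i' j' : (i' < m.+1)%N -> (j' < m.+1)%N -> y i' != z j'.
    by move=> ? ?; rewrite eq_sym zy.
  split.
    by rewrite disjoints_subset subUset !sub1set !inE !negb_or zz yy zy ?yz.
  have i_m := ltn_ord i; have j_m := ltn_ord j.
  have [zi zj yi yj] := And4 (zA i i_m) (zA j j_m) (yB i i_m) (yB j j_m).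
  have [tzi tzj tyi tyj] := And4 (thA _ zi) (thA _ zj) (thB _ yi) (thB _ yj).
  have AB u : u \in [:: z i; y i; z j; y j] -> u \in A :|: B.
    by rewrite !inE => /or4P[]/eqP ->; rewrite ?zi ?yi ?zj ?yj ?orbT.
  have ijm : (i < j < m.+1)%N by rewrite ij.
  case: (cross a0 a0 i j ijm); rewrite -/(z i) -/(z j) -/(y i) -/(y j) => hc.
    apply: (height_cross_cone (theta := theta) (sg := 1) inj _ _ _ _ _ _ hc);
      rewrite ?mulN1r ?mul1r //.
      by rewrite /= !inE !negb_or zy // zz zy // yz // yy zy.
    by move=> u /AB /alE.
  (* Here the points of [B] take the part of those of [A], which reverses the sign of [lam]. *)
  rewrite setUC (setUC [set z j]).
  apply: (height_cross_cone (theta := theta) (sg := -1) inj _ _ _ _ _ _ hc);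
    rewrite ?opprK ?mulN1r ?mul1r //.
    by rewrite /= !inE !negb_or yz // yy yz // zy // zz yz.
  by move=> u uin; apply/alE/AB; move: uin; rewrite !inE => /or4P[] ->; rewrite ?orbT.
move=> i j; rewrite neq_ltn => /orP[/main //|/main[dis cc]].
by split; [rewrite disjoint_sym|apply: cone_crossC].
Qed.

End PlaneBase.

(** * Cells of hyperplane arrangements *)

Section Coordinates.
Context {R : realFieldType} {E : nat}.
Implicit Types (h : 'cV[R]_E.+1) (x : 'rV[R]_E.+1).

Lemma pairing_mul_invmx (g : 'M[R]_E.+1) h x :
  g \in unitmx -> pairing (invmx g *m h) (x *m g) = pairing h x.
Proof. by move=> gU; rewrite pairingM mulmxK. Qed.

Lemma pairing_recl h x : pairing h x = x 0 0 * h 0 0 + pairing (row' 0 h) (col' 0 x).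
Proof.
rewrite /pairing !mxE big_ord_recl; congr (_ + _).
by apply: eq_bigr => i _; rewrite !mxE.
Qed.

Lemma hyperplane_coordinates h : h != 0 ->
  exists (f : 'rV[R]_E.+1 -> 'rV[R]_E) (r : 'cV[R]_E.+1 -> 'cV[R]_E),
    forall z h', pairing h z = 0 -> pairing h' z = pairing (r h') (f z).
Proof.
move=> h0; have [|g gU eg] := @complete_row R E h^T.
  by apply: contra h0 => /eqP e; rewrite -[h]trmxK e trmx0.
pose G := g^T; have GU : G \in unitmx by rewrite unitmx_tr.
exists (fun z => col' 0 (z *m G)), (fun h' => row' 0 (invmx G *m h')) => z h' hz.
rewrite -(pairing_mul_invmx h' z GU) pairing_recl.
have e : G *m delta_mx 0 0 = h by rewrite -[h]trmxK -eg trmx_mul trmx_delta.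
have -> : (z *m G) 0 0 = 0.
  by have := hz; rewrite /pairing -e mulmxA -colE mxE.
by rewrite mul0r add0r.
Qed.

(** Projection from the point [x0]: in a basis beginning with [x0], the matrix forgets the first
    coordinate. *)
Lemma quotient_map (x0 : 'rV[R]_E.+1) : x0 != 0 ->
  exists M : 'M[R]_(E.+1, E), (forall x, x *m M = 0 -> exists c, x = c *: x0) /\
    forall nu, pairing nu x0 = 0 -> exists nu', forall x, pairing nu' (x *m M) = pairing nu x.
Proof.
move=> x00; have [g gU eg] := complete_row x00.
have col'M x : x *m col' 0 (invmx g) = col' 0 (x *m invmx g).
  by apply/rowP => j; rewrite !mxE; apply: eq_bigr => i _; rewrite !mxE.
exists (col' 0 (invmx g)); split=> [x|nu nux0].
  rewrite col'M => e; exists ((x *m invmx g) 0 0).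
  rewrite -[x in LHS](mulmxKV gU) -eg scalemxAl; congr (_ *m g).
  apply/rowP => j; rewrite [RHS]mxE [X in _ * X]mxE /=.
  case: (unliftP 0 j) => [k ->|->]; last by rewrite eqxx mulr1.
  rewrite eq_sym (negbTE (neq_lift _ _)) mulr0.
  by have := congr1 (fun y : 'rV_E => y 0 k) e; rewrite mxE [RHS]mxE.
exists (row' 0 (g *m nu)) => x; rewrite col'M.
have -> : pairing nu x = pairing (g *m nu) (x *m invmx g).
  by rewrite pairingM mulmxKV.
rewrite pairing_recl; have -> : (g *m nu) 0 0 = 0; last by rewrite mulr0 add0r.
by have := nux0; rewrite -eg /pairing -mulmxA -rowE mxE.
Qed.

End Coordinates.

Lemma leq_expn2r m n e : (m <= n)%N -> (m ^ e <= n ^ e)%N.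
Proof. by case: e => // e mn; rewrite leq_exp2r. Qed.

Section SignPatterns.
Context {R : realFieldType}.

Let pattern E (hs : seq 'cV[R]_E) (x : 'rV[R]_E) := [seq 0 < pairing h x | h <- hs].

(** Deletion and restriction: a new hyperplane [h] only splits cells having points on both sides,
    and these leave a trace on [h], where induction applies in one dimension less. *)
Lemma sign_patterns E (hs : seq 'cV[R]_E.+1) (X : seq 'rV[R]_E.+1) :
    (exists l, forall x, x \in X -> 0 < pairing l x) ->
    (forall h x, h \in hs -> x \in X -> pairing h x != 0) ->
  (size (undup [seq pattern hs x | x <- X]) <= (size hs).+1 ^ E)%N.
Proof.
move en: (size hs) => n; elim: n E hs en X => [|n IH] E [|h hs] //= => [_|[en]] X [l lpos] nz.
  rewrite exp1n; rewrite -[1%N]/(size [:: [::] : seq bool]).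
  apply: uniq_leq_size; first exact: undup_uniq.
  by move=> r; rewrite mem_undup => /mapP[x _ ->]; rewrite inE.
have nzs h' x : h' \in hs -> x \in X -> pairing h' x != 0.
  by move=> h's; apply: nz; rewrite inE h's orbT.
have nzh x : x \in X -> pairing h x != 0 by apply: nz; rewrite mem_head.
pose pairs := [seq p <- [seq (x, y) | x <- X, y <- X] | [&& 0 < pairing h p.1,
  pairing h p.2 < 0 & pattern hs p.1 == pattern hs p.2]].
(* The point where [h] meets the segment between [p.1] and [p.2]. As a positive combination it keeps
   their common pattern and the sign of [l]. *)
pose mid (p : 'rV[R]_E.+1 * 'rV[R]_E.+1) := pairing h p.1 *: p.2 - pairing h p.2 *: p.1.
pose Z := [seq mid p | p <- pairs].
have pairsP p : p \in pairs -> [/\ p.1 \in X, p.2 \in X, 0 < pairing h p.1,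
    pairing h p.2 < 0 & pattern hs p.1 = pattern hs p.2].
  rewrite mem_filter => /andP[/and3P[h1 h2 /eqP h3] /allpairsP[q [q1 q2 ep]]].
  by move: h1 h2 h3; rewrite ep.
have midP p : p \in pairs -> [/\ pairing h (mid p) = 0, 0 < pairing l (mid p) &
    forall h', h' \in hs -> pairing h' (mid p) != 0 /\
      (0 < pairing h' (mid p)) = (0 < pairing h' p.1)].
  move=> /pairsP[x1 x2 h1 h2 ep]; have l1 := lpos _ x1; have l2 := lpos _ x2.
  rewrite /mid !pairingB !pairingZ; split; first by rewrite mulrC subrr.
    by rewrite subr_gt0; apply: lt_trans (_ : 0 < _); rewrite ?mulr_gt0 // nmulr_rlt0.
  move=> h' h's; rewrite !pairingB !pairingZ.
  have es : (0 < pairing h' p.1) = (0 < pairing h' p.2).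
    by have /(congr1 (fun r => nth false r (index h' hs))) := ep;
      rewrite !(nth_map 0) ?index_mem // nth_index.
  have := nzs h' _ h's x1; have := nzs h' _ h's x2.
  move: es; case: (ltrgt0P (pairing h' p.1)) => // c1;
    case: (ltrgt0P (pairing h' p.2)) => // c2 _ _ _.
    have : 0 < pairing h p.1 * pairing h' p.2 - pairing h p.2 * pairing h' p.1.
      by rewrite subr_gt0; apply: lt_trans (_ : 0 < _); rewrite ?mulr_gt0 // nmulr_rlt0.
    by move=> gt0; rewrite gt_eqF ?gt0.
  have : pairing h p.1 * pairing h' p.2 - pairing h p.2 * pairing h' p.1 < 0.
    by rewrite subr_lt0; apply: lt_trans (_ : _ < 0) _; rewrite ?nmulr_rgt0 ?pmulr_rlt0.
  by move=> lt0; rewrite lt_eqF // lt_gtF.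
have patZ p : p \in pairs -> pattern hs (mid p) = pattern hs p.1.
  by move=> /midP[_ _ hp]; apply/eq_in_map => h' /hp[].
pose U1 := undup [seq pattern hs x | x <- X]; pose U2 := undup [seq pattern hs z | z <- Z].
(* [b0 r] tells whether the pattern [r] occurs on the positive side of [h]. The other extension of
   [r] occurs only if both sides meet that cell, and then [r] is a pattern of [Z]. *)
pose b0 r := has (fun x => (0 < pairing h x) && (pattern hs x == r)) X.
have le12 : (size (undup [seq pattern (h :: hs) x | x <- X]) <= size U1 + size U2)%N.
  rewrite -(size_map (fun r => b0 r :: r) U1) -(size_map (fun r => ~~ b0 r :: r) U2) -size_cat.
  apply: uniq_leq_size; first exact: undup_uniq.
  move=> r; rewrite mem_undup => /mapP[x xX ->]; rewrite /= -/(pattern hs x) mem_cat.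
  have [eb|] := eqVneq (0 < pairing h x) (b0 (pattern hs x)).
    by rewrite eb (map_f (fun r => b0 r :: r)) // mem_undup map_f.
  move=> neb; have : b0 (pattern hs x).
    apply: contraNT neb => nb; rewrite (negbTE nb) eqbF_neg.
    by apply: contra nb => hx; apply/hasP; exists x; rewrite ?hx /=.
  move=> bx; move: neb; rewrite bx eqb_id => hx.
  have /hasP[x' x'X /andP[hx' /eqP px']] := bx.
  have xpair : (x', x) \in pairs.
    rewrite mem_filter /= hx' px' eqxx andbT lt_neqAle nzh //= leNgt hx.
    by apply/allpairsP; exists (x', x).
  apply/orP; right; rewrite (negbTE hx).
  apply/mapP; exists (pattern hs x); last by rewrite bx.
  by rewrite mem_undup -px' -(patZ _ xpair) map_f // map_f.
have le1 : (size U1 <= n.+1 ^ E)%N by apply: IH nzs => //; exists l.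
have [Z0|Zn0] := eqVneq Z [::].
  apply: leq_trans le12 _; rewrite /U2 Z0 /= addn0; apply: leq_trans le1 _.
  by rewrite leq_expn2r // ltnW.
have [z zZ] : exists z, z \in Z by case: (Z) Zn0 => // z Z' _; exists z; rewrite mem_head.
have [p pp ez] := mapP zZ; have [hz lz _] := midP p pp; rewrite -ez in hz lz.
have h0 : h != 0.
  have [px _ _ _ _] := pairsP p pp; apply: contra (nzh _ px) => /eqP ->.
  by rewrite /pairing mulmx0 mxE.
have [f [r fr]] := hyperplane_coordinates h0.
(* For [E] = 0 the kernel of [h] would be zero, but [l] is positive at its element [z]. *)
have E0 : (0 < E)%N.
  rewrite lt0n; apply: contraTneq lz => E0.
  rewrite (fr z l hz) /pairing mxE big1 ?ltxx // => i.
  by suff : false by []; have := ltn_ord i; move: (nat_of_ord i) => k; rewrite E0.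
have IH' E' (hs' : seq 'cV[R]_E') (X' : seq 'rV[R]_E') : (0 < E')%N -> size hs' = n ->
    (exists l, forall x, x \in X' -> 0 < pairing l x) ->
    (forall h x, h \in hs' -> x \in X' -> pairing h x != 0) ->
    (size (undup [seq pattern hs' x | x <- X']) <= n.+1 ^ E'.-1)%N.
  by case: E' hs' X' => // E' hs' X' _ sz ps ns; apply: IH sz X' ps ns.
have eU2 : U2 = undup [seq pattern (map r hs) x | x <- map f Z].
  rewrite /U2 -map_comp; congr undup; apply/eq_in_map => _ /mapP[p' pp' ->] /=.
  rewrite /pattern -map_comp; apply/eq_map => h' /=; have [hz' _ _] := midP p' pp'.
  by rewrite -fr.
have le2 : (size U2 <= n.+1 ^ E.-1)%N.
  rewrite eU2; apply: IH' => //; first by rewrite size_map.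
    exists (r l) => _ /mapP[_ /mapP[p' pp' ->] ->]; have [hz' lz' _] := midP p' pp'.
    by rewrite -fr.
  move=> _ _ /mapP[h' h's ->] /mapP[_ /mapP[p' pp' ->] ->].
  by have [hz' _ /(_ h' h's)[]] := midP p' pp'; rewrite -fr.
apply: leq_trans le12 (leq_trans (leq_add le1 le2) _).
rewrite -(prednK E0) /= !expnS.
have := @leq_expn2r n.+1 n.+2 E.-1 (leqnSn _).
set a := (_ ^ _)%N; set b := (_ ^ _)%N => ab; nia.
Qed.

End SignPatterns.

(** By averaging, some [t] separates at least one G-th of the remaining pairs, which leaves at most
    the fraction G / (G+1). After s choices less than one pair is left. *)
Lemma greedy_cover (Z T : finType) (P : {set Z}) (H : {set T}) (sep : T -> Z -> bool) (G s : nat) :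
    (forall z, z \in P -> #|H| < G * #|[set t in H | sep t z]|)%N ->
    (#|P| * G ^ s < G.+1 ^ s)%N ->
  exists ts : seq T, [/\ (size ts <= s)%N, {subset ts <= H} &
    forall z, z \in P -> has (sep ^~ z) ts].
Proof.
elim: s P => [|s IH] P sepP cP.
  exists [::]; split=> // z; move: cP; rewrite !expn0 muln1 ltnS leqn0 cards_eq0.
  by move=> /eqP ->; rewrite inE.
have [P0|/set0Pn[z0 z0P]] := eqVneq P set0; first by exists [::]; split=> // z; rewrite P0 inE.
have [t tH ct] : exists2 t, t \in H & (#|P| <= G * #|[set z in P | sep t z]|)%N.
  apply/exists_inP; apply: contraT; rewrite negb_exists_in => /forall_inP small.
  have : (\sum_(t in H) G * #|[set z in P | sep t z]| <= \sum_(t in H) #|P|)%N.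
    by apply: leq_sum => t /small; rewrite -ltnNge => /ltnW.
  have : (\sum_(z in P) #|H| < \sum_(z in P) G * #|[set t in H | sep t z]|)%N.
    rewrite [in ltnLHS](bigD1 z0) //= [in ltnRHS](bigD1 z0) //= -addSn.
    apply: leq_add; first exact: sepP.
    by apply: leq_sum => z /andP[zP _]; apply/ltnW/sepP.
  rewrite !sum_nat_const -!big_distrr /= => lt le.
  have e : #|[set p in setX H P | sep p.1 p.2]| = #|[set p in setX P H | sep p.2 p.1]|.
    have swap_inj : injective (fun p : T * Z => (p.2, p.1)) by move=> [a b] [c d] [-> ->].
    rewrite -(card_imset _ swap_inj); apply: eq_card => -[z t].
    apply/imsetP/idP => [[[t' z']]|]; rewrite !inE /=.
      by move=> /andP[/andP[a b] c] [-> ->]; rewrite a b c.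
    by move=> /andP[/andP[a b] c]; exists (t, z); rewrite ?inE /= ?a ?b ?c.
  rewrite (@card_setX_set _ _ H P sep) (@card_setX_set _ _ P H (fun z t => sep t z)) in e.
  rewrite e mulnC in le; move: lt; rewrite mulnC.
  by rewrite ltnNge; move: le; rewrite mulnC => ->.
pose P' := [set z in P | ~~ sep t z].
have cP' : (#|P'| + #|[set z in P | sep t z]| = #|P|)%N.
  rewrite addnC -(cardsID [set z | sep t z] P); congr (_ + _)%N; apply: eq_card => z.
    by rewrite !inE.
  by rewrite !inE andbC.
have [||ts [sts sub cov]] := IH P'.
- by move=> z; rewrite inE => /andP[zP _]; apply: sepP.
- move: cP; rewrite !expnS => cP.
  have step : (#|P'| * G.+1 <= #|P| * G)%N by rewrite -{}cP' in ct *; nia.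
  rewrite -(ltn_pmul2l (ltn0Sn G)); apply: leq_ltn_trans cP.
  by rewrite mulnA [in leqRHS]mulnA leq_mul2r [X in (X <= _)%N]mulnC step orbT.
exists (t :: ts); split=> //.
- by move=> u; rewrite inE => /orP[/eqP ->|/sub].
- by move=> z zP /=; case: (boolP (sep t z)) => //= nt; apply: cov; rewrite inE zP.
Qed.

(** * The inductive step *)

(** Bernoulli's inequality (1 + 1/G)^t >= 1 + t/G with denominators cleared. *)
Lemma bernoulli_pow G t : (G ^ t * (G + t) <= G.+1 ^ t * G)%N.
Proof.
elim: t => [|t IH]; first by rewrite !expn0 addn0.
rewrite !expnS -[(G.+1 * _ * _)%N]mulnA.
apply: leq_trans (_ : G.+1 * (G ^ t * (G + t)) <= _)%N; last by rewrite leq_mul2l IH.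
by move: (G ^ t)%N => a; nia.
Qed.

Lemma exp_dominates_poly C n : exists2 J, (0 < J)%N & (C * J ^ n < 2 ^ J)%N.
Proof.
pose j := (C + n.*2)%N; exists (2 ^ j.*2)%N; first by rewrite expn_gt0.
have jj : (j * j + j < 2 ^ j.*2)%N.
  have := ltn_expl j (isT : (1 < 2)%N); rewrite -addnn expnD.
  by move: (2 ^ j)%N => a; nia.
rewrite -expnM; apply: leq_ltn_trans (_ : 2 ^ C * 2 ^ (j.*2 * n) < _)%N.
  by rewrite leq_mul2r ltnW ?orbT // ltn_expl.
rewrite -expnD ltn_exp2l //; apply: leq_ltn_trans jj.
rewrite /j -!addnn; nia.
Qed.

(** An integer substitute for the root of order n+1, rounded up; rounding at most doubles it. *)
Lemma ceil_root m n : (0 < m)%N ->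
  exists mu, [/\ (0 < mu)%N, (m <= mu ^ n.+1)%N & (mu ^ n.+1 <= 2 ^ n.+1 * m)%N].
Proof.
move=> m0; have exP : exists mu, (m <= mu ^ n.+1)%N.
  by exists m; rewrite -{1}[m]expn1 leq_pexp2l.
have [mu mP mmin] := ex_minnP exP.
have mu0 : (0 < mu)%N by case: mu mP {mmin} => // ; rewrite exp0n //; lia.
exists mu; split=> //; have [mu1|mu1] := leqP mu 1.
  apply: leq_trans (_ : 1 ^ n.+1 <= _)%N; first exact: leq_expn2r.
  by rewrite exp1n muln_gt0 expn_gt0.
have lt : (mu.-1 ^ n.+1 < m)%N.
  by rewrite ltnNge; apply/negP => /mmin; lia.
apply: leq_trans (_ : (2 * mu.-1) ^ n.+1 <= _)%N; first by apply: leq_expn2r; lia.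
by rewrite expnMn leq_mul2l ltnW // orbT.
Qed.

(* [k] points of B survive the pruning, each hyperplane of the greedy cover
   divides the number of far pairs left by at least [G.+1 / G], and [a] points
   guarantee [M] of them in one cell of [s] hyperplanes. *)
Lemma step_parameters e c p : (0 < e)%N -> (0 < c)%N -> (1 < p)%N ->
  exists c', forall m, (0 < m)%N ->
    let M := (2 * m)%N in let k := (c * M ^ p)%N in
    let G := (2 ^ e.+2 * e.+1 ^ 2 * k ^ e)%N in
  exists s, let a := (M * s.+1 ^ e.+1)%N in
    (a ^ 2 * G ^ s < G.+1 ^ s)%N /\
    (a + 2 * k <= c' * m ^ (p * (e ^ 2 + e + 1)))%N.
Proof.
move=> e0 c0 p1.
pose g0 := (2 ^ e.+2 * e.+1 ^ 2)%N; pose g1 := (g0 * (c * 2 ^ p) ^ e)%N.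
pose C1 := (2 * (2 * g1) ^ e.+1)%N; pose q := (e.+1 + (e.+1 * p * e + 1) * e.+1)%N.
(* [J] depends on [e], [c] and [p] only. It is the exponent that beats the polynomial growth of
   [a ^ 2] in [mu], constants included. *)
have [J J0 hJ] := exp_dominates_poly (C1 ^ 2 * 2 ^ (q * 2)) (e.+1 * 2).
pose C2 := (2 * (2 * J * g0) ^ e.+1 * 2 ^ e.+1 * (c * 2 ^ p) ^ (e * e.+1))%N.
exists (C2 + 2 * (c * 2 ^ p))%N => m m0 M k G.
(* Since [mu ^ e.+1] is about m, a factor [mu] in [s] costs only one factor m in [a]. The resulting
   exponent 2 + p e (e+1) is at most p (e^2+e+1), as p is at least 2. *)
have [mu [mu0 m_mu mu_m]] := ceil_root e m0.
have g00 : (0 < g0)%N by rewrite /g0 muln_gt0 !expn_gt0.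
have kE : k = (c * 2 ^ p * m ^ p)%N by rewrite /k /M expnMn mulnA.
have k0 : (0 < k)%N by rewrite kE !muln_gt0 c0 !expn_gt0 m0.
have GE : G = (g0 * k ^ e)%N by [].
clearbody G k.
have G0 : (0 < G)%N by rewrite GE muln_gt0 g00 expn_gt0 k0.
exists (G * mu * J)%N; move=> a.
have s1 : ((G * mu * J).+1 <= 2 * (G * mu * J))%N.
  by have : (0 < G * mu * J)%N; [rewrite !muln_gt0 G0 mu0 J0|lia].
have aub : (a <= 2 * m * (2 * (G * mu * J)) ^ e.+1)%N.
  by rewrite /a /M leq_mul2l leq_expn2r // orbT.
split.
  (* Each block of G mu rounds gains a factor mu+1 by Bernoulli, and there are [J] blocks. *)
  have gain : (mu.+1 ^ J * G ^ (G * mu * J) <= G.+1 ^ (G * mu * J))%N.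
    rewrite ![(_ ^ (_ * J))%N]expnM -expnMn; apply: leq_expn2r.
    rewrite -(leq_pmul2r G0); apply: leq_trans (bernoulli_pow G (G * mu)).
    by move: (G ^ (G * mu))%N => x; apply: eq_leq; ring.
  apply: leq_trans gain; rewrite ltn_mul2r expn_gt0 G0 /=.
  have Gmu : (G <= g1 * mu ^ (e.+1 * p * e))%N.
    rewrite GE /g1 -mulnA leq_mul2l; apply/orP; right.
    rewrite [(mu ^ _)%N]expnM -expnMn; apply: leq_expn2r.
    by rewrite kE leq_mul2l expnM leq_expn2r ?orbT.
  have g10 : (0 < g1)%N by rewrite /g1 muln_gt0 g00 expn_gt0 muln_gt0 c0 expn_gt0.
  clearbody g1.
  have a_mu : (a <= C1 * J ^ e.+1 * mu ^ q)%N.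
    apply: leq_trans aub _.
    apply: leq_trans (_ : 2 * mu ^ e.+1 * (2 * (g1 * mu ^ (e.+1 * p * e) * mu * J)) ^ e.+1 <= _)%N.
      apply: leq_mul; first by rewrite leq_mul2l m_mu orbT.
      by apply: leq_expn2r; rewrite leq_mul2l !leq_mul2r Gmu !orbT.
    have -> : (mu ^ q = mu ^ e.+1 * (mu ^ (e.+1 * p * e) * mu) ^ e.+1)%N.
      by rewrite /q expnD [(mu ^ (_ * e.+1))%N]expnM addn1 -expnSr.
    rewrite /C1 !expnMn; apply: eq_leq.
    by move: (mu ^ _)%N ((mu ^ _) ^ _)%N (2 ^ _)%N (g1 ^ _)%N (J ^ _)%N => x y z t w; ring.
  have Jq : (q * 2 <= J)%N.
    rewrite -(leq_exp2l _ _ (isT : (1 < 2)%N)); apply: leq_trans (ltnW hJ).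
    rewrite mulnAC leq_pmull // muln_gt0 !expn_gt0 J0 /C1.
    by rewrite muln_gt0 expn_gt0 muln_gt0 g10.
  clearbody C1.
  apply: leq_ltn_trans (_ : (C1 * J ^ e.+1 * mu ^ q) ^ 2 < _)%N; first exact: leq_expn2r.
  apply: leq_trans (_ : mu ^ (q * 2) * 2 ^ (J - q * 2) <= _)%N; last first.
    rewrite -{2}(subnKC Jq) expnD; apply: leq_mul; apply: leq_expn2r => //.
  rewrite !expnMn -!expnM mulnC ltn_mul2l expn_gt0 mu0 /=.
  rewrite -(ltn_pmul2l (_ : 0 < 2 ^ (q * 2))%N) ?expn_gt0 // -expnD subnKC //.
  apply: leq_trans hJ; rewrite ltnS; apply: eq_leq.
  by rewrite mulnA [(_ * C1 ^ 2)%N]mulnC.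
rewrite mulnDl; apply: leq_add; last first.
  rewrite kE !mulnA leq_mul2l leq_pexp2l ?orbT //.
  by rewrite leq_pmulr // addn1.
apply: leq_trans aub _.
have -> : ((2 * (G * mu * J)) ^ e.+1 = (2 * J * g0) ^ e.+1 * (k ^ e) ^ e.+1 * mu ^ e.+1)%N.
  by rewrite GE !expnMn; ring.
apply: leq_trans (_ : 2 * m * ((2 * J * g0) ^ e.+1 * (k ^ e) ^ e.+1 * (2 ^ e.+1 * m)) <= _)%N.
  by rewrite !leq_mul2l mu_m !orbT.
rewrite -expnM kE [((_ * m ^ p) ^ _)%N]expnMn -[((m ^ p) ^ _)%N]expnM.
apply: leq_trans (_ : C2 * m ^ (2 + p * (e * e.+1)) <= _)%N.
  by rewrite /C2 expnD; apply: eq_leq; ring.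
rewrite leq_mul2l leq_pexp2l ?orbT //; nia.
Qed.

Lemma bin_leq_exp n k : ('C(n, k) <= n ^ k)%N.
Proof.
apply: leq_trans (_ : n ^_ k <= _)%N; last first.
  elim: k n => [|k IH] n; first by rewrite ffactn0.
  rewrite ffactnS expnS leq_mul2l; apply/orP; right; apply: leq_trans (IH _) _.
  by apply: leq_expn2r; apply: leq_pred.
by rewrite -bin_ffact leq_pmulr // fact_gt0.
Qed.

Lemma pigeonhole_size (I : finType) (T : eqType) (A : {set I}) (f : I -> T) C M :
    (0 < M)%N -> (size (undup [seq f x | x <- enum A]) <= C)%N -> (M * C <= #|A|)%N ->
    (0 < #|A|)%N ->
  exists r, (M <= #|[set x in A | f x == r]|)%N.
Proof.
move=> M0; set U := undup _ => cU cA /card_gt0P[x0 x0A].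
have fU x : x \in A -> f x \in U by move=> xA; rewrite mem_undup map_f // mem_enum.
have U0 : (0 < size U)%N by have := fU _ x0A; rewrite -index_mem; apply: leq_ltn_trans.
pose g x : 'I_(size U) := insubd (Ordinal U0) (index (f x) U).
have gE x : x \in A -> g x = index (f x) U :> nat.
  by move=> xA; rewrite insubdK // -topredE /= index_mem fU.
suff [j cj] : exists j, (M <= #|[set x in A | g x == j]|)%N.
  exists (nth (f x0) U j); apply: leq_trans cj _; apply: subset_leq_card.
  apply/subsetP => x; rewrite !inE => /andP[xA /eqP <-]; rewrite xA /= gE //.
  by rewrite nth_index // fU.
apply/existsP; apply: contraT; rewrite negb_exists => /forallP small.
have : (#|A| <= \sum_(j < size U) M.-1)%N.
  rewrite -sum1_card (partition_big g predT) //=; apply: leq_sum => j _.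
  rewrite sum1dep_card; have := small j; rewrite -ltnNge.
  by move: M0; case: (M) => // M' _; rewrite ltnS.
rewrite sum_nat_const card_ord => le; clear -M0 cA cU U0 le.
have : (size U * M.-1 <= C * M.-1)%N by rewrite leq_mul2r cU orbT.
nia.
Qed.

(** Two averagings: one over the points of [B], discarding those contained in too many sets of the
    [H i], and one over the cyclic shifts that assign an index i to each [sg j]. *)
Lemma prune_and_assign (I : finType) (e k m M : nat) (B : {set I})
    (H : 'I_M.+1 -> {set {set I}}) :
    (0 < e)%N -> M.+1 = (2 * m)%N -> #|B| = (2 * k)%N ->
    (forall i t, t \in H i -> t \subset B /\ #|t| = e.+1) ->
    (forall i, 2 * e.+1 ^ 2 * #|H i| <= k)%N ->
  exists B' : {set I}, [/\ B' \subset B, (k <= #|B'|)%N &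
    forall sg : 'I_M.+1 -> {set I},
      (forall j, sg j \subset B' /\ #|sg j| = e) ->
      (forall j l, j != l -> [disjoint sg j & sg l]) ->
    exists (J : {set 'I_M.+1}) (r : 'I_M.+1), (m <= #|J|)%N /\
      forall j l t, j \in J -> j != l -> t \in H (j + r) -> ~~ (t \subset sg j :|: sg l)].
Proof.
move=> e0 Mm cB HP cH.
pose deg b := (\sum_i #|[set t in H i | b \in t]|)%N.
have sum_deg : (2 * e.+1 * (\sum_(b in B) deg b) <= M.+1 * k)%N.
  have -> : (\sum_(b in B) deg b = \sum_i e.+1 * #|H i|)%N.
    rewrite exchange_big; apply: eq_bigr => i _ /=.
    rewrite -(@card_setX_set _ _ B (H i) (fun b t => b \in t)).
    have := @card_setX_set _ _ (H i) B (fun t b => b \in t).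
    rewrite (eq_bigr (fun _ => e.+1)) => [|t tH]; last first.
      have [sB <-] := HP i t tH; apply: eq_card => b; rewrite !inE andb_idl //.
      exact: subsetP.
    rewrite sum_nat_const mulnC => <-.
    have swap_inj : injective (fun p : {set I} * I => (p.2, p.1)) by move=> [a b] [c d] [-> ->].
    rewrite -(card_imset _ swap_inj); apply: eq_card => -[b t].
    apply/idP/imsetP => [|[[t' b']]]; rewrite !inE /=.
      by move=> /andP[/andP[x y] z]; exists (t, b); rewrite ?inE /= ?x ?y ?z.
    by move=> /andP[/andP[x y] z] [-> ->]; rewrite x y z.
  rewrite big_distrr /= -[X in (_ <= X * k)%N]card_ord -sum_nat_const.
  by apply: leq_sum => i _; apply: leq_trans (cH i); apply: eq_leq; ring.
(* Points of degree above (M+1)/(2e); by [sum_deg] they are at most half of [B]. *)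
pose V := [set b in B | (M.+1 < 2 * e * deg b)%N].
have sVB : V \subset B by apply/subsetP => b; rewrite inE => /andP[].
have cV : (#|V| <= k)%N.
  rewrite -(leq_pmul2l (ltn0Sn M)); apply: leq_trans sum_deg.
  apply: leq_trans (_ : \sum_(b in V) 2 * e * deg b <= _)%N.
    rewrite mulnC -sum_nat_const; apply: leq_sum => b; rewrite inE => /andP[_].
    exact: ltnW.
  rewrite -big_distrr /= leq_mul //; first by rewrite leq_mul2l leqnSn orbT.
  by rewrite [leqRHS](big_setID V) /= (setIidPr sVB) leq_addr.
exists (B :\: V); split; first exact: subsetDl.
  by rewrite cardsD (setIidPr sVB) cB; lia.
move=> sg sgP dis.
have sgB j : sg j \subset B by have [/subset_trans-> //] := sgP j; apply: subsetDl.
(* The indices [l] for which assigning i to [sg j] is spoilt by [sg l]. *)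
pose L i j := [set l | (l != j) && [exists t in H i, t \subset sg j :|: sg l]].
have cL i j : (#|L i j| <= \sum_(b in sg j) #|[set t in H i | b \in t]|)%N.
  rewrite -(@card_setX_set _ _ (sg j) (H i) (fun b t => b \in t)).
  have exw l : l \in L i j -> exists p : I * {set I},
      [/\ p.1 \in sg j, p.2 \in H i, p.1 \in p.2 & p.2 \subset sg j :|: sg l].
    rewrite inE => /andP[lj /exists_inP[t tH st]].
    have [_ ct] := HP i t tH; have [_ cl] := sgP l.
    have /subsetPn[b bt bl] : ~~ (t \subset sg l).
      by apply/negP => /subset_leq_card; rewrite ct cl ltnn.
    exists (b, t); split=> //=; have := subsetP st b bt.
    by rewrite inE (negbTE bl) orbF.
  have [b0 b0j] : exists b0, b0 \in sg j.
    by have [_ cj] := sgP j; apply/card_gt0P; rewrite cj.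
  have /choice[w wP] : forall l, exists p : I * {set I}, l \in L i j ->
      [/\ p.1 \in sg j, p.2 \in H i, p.1 \in p.2 & p.2 \subset sg j :|: sg l].
    by move=> l; have [/exw[p pP]|_] := boolP (l \in L i j); [exists p|exists (b0, set0)].
  (* A set spoiling both [l] and [l'] would lie inside [sg j], as [sg l] and [sg l'] are disjoint,
     but it has e+1 elements. *)
  have winj : {in L i j &, injective w}.
    move=> l l' lL l'L ew; have [w1 w2 w3 w4] := wP l lL; have [_ _ _ w4'] := wP l' l'L.
    apply/eqP; apply: contraT => ll'; rewrite -ew in w4'.
    have : (w l).2 \subset sg j.
      apply/subsetP => b bw; have := subsetP w4 b bw; have := subsetP w4' b bw.
      rewrite !inE; case: (b \in sg j) => //= bl' bl.
      by have := disjointFr (dis _ _ ll') bl; rewrite bl'.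
    have [_ ct] := HP i _ w2; have [_ cj] := sgP j.
    by move=> /subset_leq_card; rewrite ct cj ltnn.
  rewrite -(card_in_imset winj); apply: subset_leq_card; apply/subsetP => _ /imsetP[l lL ->].
  by have [w1 w2 w3 _] := wP l lL; rewrite !inE w1 w2 w3.
have total : (2 * (\sum_j \sum_i #|L i j|) <= M.+1 * M.+1)%N.
  rewrite -[X in (_ <= X * _)%N]card_ord -sum_nat_const big_distrr /=.
  apply: leq_sum => j _; have [sj cj] := sgP j.
  rewrite -(leq_pmul2l e0); apply: leq_trans (_ : 2 * e * (\sum_(b in sg j) deg b) <= _)%N.
    rewrite mulnA [(e * 2)%N]mulnC leq_mul2l; apply/orP; right.
    by rewrite exchange_big /=; apply: leq_sum => i _; apply: cL.
  rewrite big_distrr /= -[X in (_ <= X * _)%N]cj -sum_nat_const; apply: leq_sum => b bj.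
  by have := subsetP sj b bj; rewrite !inE => /andP[+ bB]; rewrite bB -leqNgt.
(* Addition is modulo M+1, so every pair of an index and a simplex occurs in exactly one shift. The
   best shift has at most (M+1)/2 = m conflicts. *)
have [r cr] : exists r : 'I_M.+1, (M.+1 * \sum_j #|L (j + r)%R j| <= \sum_j \sum_i #|L i j|)%N.
  apply/existsP; apply: contraT; rewrite negb_exists => /forallP big.
  have shift : (\sum_r \sum_j #|L (j + r)%R j| = \sum_j \sum_i #|L i j|)%N.
    rewrite exchange_big; apply: eq_bigr => j _ /=.
    by rewrite [RHS](reindex_inj (addrI j)).
  have : (\sum_(r < M.+1) (\sum_j \sum_i #|L i j|) < \sum_r M.+1 * \sum_j #|L (j + r)%R j|)%N.
    rewrite [in ltnLHS](bigD1 ord0) //= [in ltnRHS](bigD1 ord0) //= -addSn.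
    apply: leq_add; first by rewrite ltnNge.
    by apply: leq_sum => r _; rewrite ltnW // ltnNge.
  by rewrite -big_distrr /= shift sum_nat_const card_ord ltnn.
exists [set j | L (j + r) j == set0], r; split.
  have : (#|~: [set j | L (j + r)%R j == set0]| <= \sum_j #|L (j + r)%R j|)%N.
    rewrite -sum1_card [leqRHS](bigID (mem (~: [set j | L (j + r) j == set0]))) /=.
    apply: leq_trans (leq_addr _ _); apply: leq_sum => j; rewrite !inE => /set0Pn ne.
    by apply/card_gt0P.
  rewrite -(leq_add2l #|[set j | L (j + r)%R j == set0]|) cardsC card_ord.
  have : (2 * (\sum_j #|L (j + r)%R j|) <= M.+1)%N.
    rewrite -(leq_pmul2l (ltn0Sn M)) mulnCA; apply: leq_trans total.
    by rewrite leq_mul2l cr orbT.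
  by move: (\sum_j _)%N #|_| => x y; clear -Mm; lia.
move=> j l t; rewrite inE => /eqP Lj jl tH; apply/negP => st.
have : l \in L (j + r) j by rewrite inE eq_sym jl; apply/exists_inP; exists t.
by rewrite Lj inE.
Qed.

Definition separating (R : realFieldType) (I : finType) E
    (v : I -> 'rV[R]_E) (hyp : {set I} -> 'cV[R]_E) n (B : {set I}) x y :=
  [set t : {set I} | (t \subset B) && (#|t| == n) &&
     ((0 < pairing (hyp t) (v x)) != (0 < pairing (hyp t) (v y)))].

(** A pair is far if too many hyperplanes spanned by [B] separate it. The greedy choice of [s]
    hyperplanes separates all far pairs, so any two points in one cell are near, and some cell is
    crowded. *)
Lemma near_cluster (R : realFieldType) (I : finType) e
    (v : I -> 'rV[R]_e.+2) (hyp : {set I} -> 'cV[R]_e.+2)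
    (A B : {set I}) M k s :
    pointed v A -> #|B| = (2 * k)%N -> (0 < k)%N ->
    (forall (t : {set I}) x, t \subset B -> #|t| = e.+1 -> x \in A -> pairing (hyp t) (v x) != 0) ->
    #|A| = (M.+1 * s.+1 ^ e.+1)%N ->
    (let G := (2 ^ e.+2 * e.+1 ^ 2 * k ^ e)%N in #|A| ^ 2 * G ^ s < G.+1 ^ s)%N ->
  exists C : {set I}, [/\ C \subset A, (M.+1 <= #|C|)%N &
    forall x y, x \in C -> y \in C -> (2 * e.+1 ^ 2 * #|separating v hyp e.+1 B x y| <= k)%N].
Proof.
move=> [l lpos] cB k0 nz cA; set G := (_ * k ^ e)%N => /= ineq.
pose H := [set t : {set I} | (t \subset B) && (#|t| == e.+1)].
have cH : (#|H| <= (2 * k) ^ e.+1)%N by rewrite cards_draws cB bin_leq_exp.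
pose sep t (z : I * I) := (0 < pairing (hyp t) (v z.1)) != (0 < pairing (hyp t) (v z.2)).
have sepE z : [set t in H | sep t z] = separating v hyp e.+1 B z.1 z.2.
  by apply/setP => t; rewrite !inE.
pose P := [set z in setX A A | (k < 2 * e.+1 ^ 2 * #|[set t in H | sep t z]|)%N].
have cP : (#|P| <= #|A| ^ 2)%N.
  rewrite -mulnn -cardsX; apply: subset_leq_card.
  by apply/subsetP => z; rewrite !inE => /andP[].
have [z||ts [sts subt cov]] := @greedy_cover _ _ P H sep G s.
(* [G] is designed for this: at most (2k)^(e+1) hyperplanes exist, and a far pair is separated by
   more than k / (2 (e+1)^2) of them. *)
- rewrite inE => /andP[_ big]; apply: leq_ltn_trans cH _.
  rewrite expnMn [(k ^ e.+1)%N]expnSr mulnA /G [(2 ^ e.+2)%N]expnS.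
  move: (#|_|) big => y big.
  have p0 : (0 < 2 ^ e.+1 * k ^ e)%N by rewrite muln_gt0 !expn_gt0 k0.
  have := big; rewrite -(ltn_pmul2l p0) => lt; apply: leq_trans lt _.
  by apply: eq_leq; move: (2 ^ e.+1)%N (e.+1 ^ 2)%N (k ^ e)%N => a b c; ring.
- by apply: leq_ltn_trans ineq; rewrite leq_mul2r cP orbT.
pose pat x := [seq 0 < pairing h (v x) | h <- map hyp ts].
have [||||r cr] := @pigeonhole_size I _ A pat (s.+1 ^ e.+1)%N M.+1.
- by [].
- rewrite /pat (map_comp (fun y => [seq 0 < pairing h y | h <- map hyp ts]) v).
  apply: leq_trans (@sign_patterns _ _ (map hyp ts) _ _ _) _.
  + by exists l => y /mapP[x + ->]; rewrite mem_enum => xA; apply: lpos.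
  + move=> h y /mapP[t /subt tH ->] /mapP[x xA ->]; move: tH xA.
    rewrite mem_enum inE => /andP[tB /eqP ct] xA.
    exact: nz.
  + by apply: leq_expn2r; rewrite size_map ltnS.
- by rewrite cA.
- by rewrite cA muln_gt0 expn_gt0.
exists [set x in A | pat x == r]; split=> //; first by apply/subsetP => x; rewrite inE => /andP[].
move=> x y; rewrite !inE => /andP[xA /eqP px] /andP[yA /eqP py].
rewrite leqNgt; apply/negP => big.
have /cov/hasP[t tts] : (x, y) \in P by rewrite inE in_setX xA yA sepE.
rewrite /sep /=; have := congr1 (fun p => nth false p (index t ts)) (etrans px (esym py)).
by rewrite /pat -!map_comp !(nth_map set0) ?index_mem // nth_index //= => ->; rewrite eqxx.
Qed.

(** [e] is the dimension before lifting in the hypothesis; the factor e^2+e+1 is d^2-d+1 for the new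
    dimension d = e+1. *)
Lemma crossing_step (R : realFieldType) e c p : (1 < e)%N -> (0 < c)%N -> (1 < p)%N ->
    (forall (I : finType) (v : I -> 'rV[R]_e.+1) (S : {set I}) m, general v S -> pointed v S ->
       (c * m ^ p <= #|S|)%N -> crossing_system v S m) ->
  exists2 c', (0 < c')%N & forall (I : finType) (v : I -> 'rV[R]_e.+2) (S : {set I}) m,
    general v S -> pointed v S -> (c' * m ^ (p * (e ^ 2 + e + 1)) <= #|S|)%N ->
    crossing_system v S m.
Proof.
move=> e1 c0 p1 IH; have e0 : (0 < e)%N by apply: ltnW.
have [c' hc'] := step_parameters e0 c0 p1.
(* The summand e+2 guarantees enough points for general position to apply when m is positive. *)
exists (c' + e.+2)%N => [|I v S m gS [l lpos] cS]; first by rewrite addnS.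
case: (posnP m) => [m0|m0]; first by move: cS; rewrite m0; exists (fun=> set0); case.
have [s [ineq bound]] := hc' m m0.
set k := (c * (2 * m) ^ p)%N in ineq bound; set a := (2 * m * s.+1 ^ e.+1)%N in ineq bound.
have k0 : (0 < k)%N by rewrite /k muln_gt0 c0 expn_gt0 muln_gt0 m0.
have cSE : (e.+2 <= #|S|)%N.
  apply: leq_trans cS; rewrite mulnDl; apply: leq_trans (leq_addl _ _).
  by rewrite leq_pmulr // expn_gt0 m0.
have cSak : (a + 2 * k <= #|S|)%N.
  by apply: leq_trans bound (leq_trans _ cS); rewrite mulnDl leq_addr.
have [A [B [lam [[sA cA] [sB cB] dAB sep]]]] := separated_subsets gS lpos cSE cSak.
have AS x : x \in A -> x \in S by apply: (subsetP sA).
have BS x : x \in B -> x \in S by apply: (subsetP sB).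
have [M eM] : exists M, (2 * m)%N = M.+1 by exists (2 * m).-1; rewrite prednK // muln_gt0 m0.
have /choice[hyp hypP] : forall t : {set I}, exists h : 'cV[R]_e.+2, #|t| = e.+1 ->
    h != 0 /\ forall u, u \in t -> pairing h (v u) = 0.
  move=> t; have [ct|ct] := eqVneq #|t| e.+1; last by exists 0 => /eqP; rewrite (negbTE ct).
  have [|h h0 hv] := @vanishing_form _ _ _ v t; first by rewrite ct.
  by exists h.
have hyp_neq0 (t : {set I}) x : t \subset B -> #|t| = e.+1 -> x \in A -> pairing (hyp t) (v x) != 0.
  move=> tB ct xA; have [h0 hv] := hypP t ct; apply: contra h0 => /eqP hx.
  have xt : x \notin t by apply/negP => /(subsetP tB); rewrite (disjointFr dAB xA).
  have cxt : #|x |: t| = e.+2 by rewrite cardsU1 xt ct.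
  have sxt : x |: t \subset S by rewrite subUset sub1set AS //= (subset_trans tB sB).
  apply/eqP; apply: (form_eq0 (gS _ sxt cxt) cxt) => u; rewrite !inE => /orP[/eqP -> //|].
  exact: hv.
have pA : pointed v A by exists l => u /AS /lpos.
have cA' : #|A| = (M.+1 * s.+1 ^ e.+1)%N by rewrite cA /a eM.
have [C [sCA cC near]] : exists C : {set I}, [/\ C \subset A, (M.+1 <= #|C|)%N &
    forall x y, x \in C -> y \in C ->
      (2 * e.+1 ^ 2 * #|separating v hyp e.+1 B x y| <= k)%N].
  by apply: near_cluster cB k0 hyp_neq0 cA' _ => //=; rewrite cA.
pose al (i : 'I_M.+1) := enum_val (widen_ord cC i).
have alC i : al i \in C by apply: enum_valP.
have alA i : al i \in A by apply: (subsetP sCA).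
have al_inj : injective al.
  by move=> i j /enum_val_inj /(congr1 val) /= ij; apply: val_inj.
(* The common centre of projection. Being in the same cluster, the other [al i] are separated from
   it by few hyperplanes. *)
pose x0 := al 0; have x0A : x0 \in A := alA 0.
have [||B' [sB' cB' assign]] := @prune_and_assign I e k m M B
    (fun i => separating v hyp e.+1 B x0 (al i)) e0 (esym eM) cB.
- by move=> i t; rewrite inE -andbA => /and3P[tB /eqP ct _].
- by move=> i; apply: near; apply: alC.
have B'S u : u \in B' -> u \in S by move/(subsetP sB')/BS.
have B'A u x : u \in B' -> x \in A -> u != x.
  by move=> uB xA; apply: contraTneq xA => <-; rewrite (disjointFl dAB) // (subsetP sB').
have vx0 : v x0 != 0.
  have : independent v [set x0].
    by apply: general_independent gS _ _ cSE; rewrite ?sub1set ?AS // cards1.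
  by move/independent_neq0; apply; rewrite inE.
have [Q [kerQ dualQ]] := quotient_map vx0.
have genQ : general (fun u => v u *m Q) B'.
  move=> T sT cT w w0 u uT.
  have x0T : x0 \notin T.
    by apply/negP => x0T; have := B'A x0 x0 (subsetP sT _ x0T) x0A; rewrite eqxx.
  have [d ed] : exists d, \sum_(t in T) w t *: v t = d *: v x0.
    apply: kerQ; rewrite mulmx_suml -[RHS]w0; apply: eq_bigr => t _.
    by rewrite -scalemxAl.
  have cxT : #|x0 |: T| = e.+2 by rewrite cardsU1 x0T cT.
  have sxT : x0 |: T \subset S.
    by rewrite subUset sub1set AS //=; apply/subsetP => t /(subsetP sT)/B'S.
  have := gS _ sxT cxT (fun t => if t == x0 then - d else w t).
  rewrite big_setU1 //= eqxx scaleNr.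
  have -> : \sum_(t in T) (if t == x0 then - d else w t) *: v t = d *: v x0.
    rewrite -ed; apply: eq_bigr => t tT; case: eqP => // tx0.
    by move: x0T; rewrite -tx0 tT.
  rewrite addNr => /(_ erefl u); rewrite inE uT orbT => /(_ isT).
  by case: eqP => // ux0; move: x0T; rewrite -ux0 uT.
(* The form [nu] is [lam] corrected by a multiple of [l] to vanish at [x0]. It stays positive on
   [B], which lies strictly beyond [x0]. *)
have ptQ : pointed (fun u => v u *m Q) B'.
  pose nu := lam - (pairing lam (v x0) / pairing l (v x0)) *: l.
  have lx0 : 0 < pairing l (v x0) by apply/lpos/AS.
  have [|nu' nu'E] := dualQ nu.
    by rewrite pairingBl pairingZl divfK ?subrr // gt_eqF.
  exists nu' => u uB'; rewrite nu'E pairingBl pairingZl subr_gt0 mulrAC ltr_pdivrMr //.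
  exact: sep x0A (subsetP sB' u uB').
have [|sg sgP sgX] := IH _ _ B' M.+1 genQ ptQ; first by rewrite -eM.
have [J [r [cJ good]]] := assign sg sgP (fun j l jl => (sgX j l jl).1).
have sgB j : sg j \subset B by have [/subset_trans-> //] := sgP j.
have alsg i j : al i \notin sg j.
  by apply/negP => /(subsetP (sgB j)); rewrite (disjointFr dAB (alA i)).
have lift_cross j q w d : j \in J -> q \in J -> j != q ->
    (forall u, u \in sg j :|: sg q -> 0 < w u) -> 0 <= d ->
    \sum_(u in sg j) w u *: v u + d *: v x0 = \sum_(u in sg q) w u *: v u ->
    cone_cross v (al (j + r) |: sg j) (al (q + r) |: sg q).
  move=> jJ qJ jq wpos d0 ew.
  have dis := (sgX j q jq).1; have [[_ cj] [_ cq]] := (sgP j, sgP q).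
  have sBjq : sg j :|: sg q \subset B by rewrite subUset !sgB.
  have alX i : al i \notin sg j :|: sg q by rewrite inE negb_or !alsg.
  apply: (cone_cross_transfer gS) wpos d0 ew _ => //.
  - exact: subset_trans sBjq sB.
  (* The 2e vertices must number at least e+2, which holds from e = 2 on: hence the induction starts
     in the plane. *)
  - have [_ /esym] := leq_card_setU (sg j) (sg q); rewrite dis cj cq => /esym/eqP ->.
    by rewrite addnn -mul2n; clear -e1; lia.
  - exact: AS.
  - exact: alX.
  - by apply: contra jq => /eqP /al_inj e'; apply/eqP; apply: (addIr r e').
  move=> t st ct; have [_ hv] := hypP t ct; exists (hyp t) => //.
  have tB := subset_trans st sBjq.
  have := good j q t jJ jq; rewrite st => /contraTN.
  rewrite inE tB ct eqxx /= negbK => /(_ isT)/eqP.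
  have := hyp_neq0 t _ tB ct x0A; have := hyp_neq0 t _ tB ct (alA (j + r)).
  case: (ltrgt0P (pairing (hyp t) (v x0))) => // c1;
    case: (ltrgt0P (pairing (hyp t) (v (al (j + r))))) => // c2 _ _ _.
    exact: mulr_gt0.
  by rewrite nmulr_lgt0.
pose f (i : 'I_m) := enum_val (widen_ord cJ i).
have fJ i : f i \in J by apply: enum_valP.
have f_inj : injective f by move=> i j /enum_val_inj /(congr1 val) /= ij; apply: val_inj.
exists (fun i => al (f i + r) |: sg (f i)) => [i|i j ij].
  have [_ ci] := sgP (f i); split; last by rewrite cardsU1 alsg ci.
  by rewrite subUset sub1set AS //= (subset_trans (sgB _) sB).
have fij : f i != f j by apply: contra ij => /eqP /f_inj ->.
have [dis [w wpos ew]] := sgX _ _ fij; split.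
  rewrite disjoints_subset subUset sub1set !inE negb_or alsg andbT.
  rewrite (_ : al _ != al _); last first.
    by apply: contra fij => /eqP /al_inj e'; apply/eqP; apply: (addIr r e').
  apply/subsetP => u us; rewrite !inE negb_or (disjointFr dis us) andbT.
  by apply: contraTneq us => ->; apply: alsg.
have [d ed] : exists d,
    \sum_(u in sg (f i)) w u *: v u - \sum_(u in sg (f j)) w u *: v u = d *: v x0.
  apply: kerQ; rewrite mulmxBl !mulmx_suml; apply/eqP; rewrite subr_eq0; apply/eqP.
  by under eq_bigr do rewrite -scalemxAl; under [RHS]eq_bigr do rewrite -scalemxAl.
(* The crossing in the quotient lifts up to a multiple of [v x0]; its sign decides which simplex
   takes [x0] as an additional vertex. *)
have [d0|d0] := leP d 0.
  apply: (lift_cross _ _ w (- d)) => //; first by rewrite oppr_ge0.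
  by rewrite scaleNr -ed opprB addrC subrK.
apply: cone_crossC; apply: (lift_cross _ _ w d); rewrite ?(ltW d0) 1?eq_sym //.
  by move=> u; rewrite setUC; apply: wpos.
by rewrite -ed addrC subrK.
Qed.

(** * Point sets *)

Definition crossing_exponent d := (2 * \prod_(3 <= i < d.+1) (i ^ 2 - i + 1))%N.

Lemma crossing_exponentS e :
  crossing_exponent e.+3 = (crossing_exponent e.+2 * (e.+2 ^ 2 + e.+2 + 1))%N.
Proof.
rewrite /crossing_exponent big_nat_recr //= mulnA; congr (_ * _)%N.
by rewrite addn1; lia.
Qed.

Lemma crossing_exponent_gt1 e : (1 < crossing_exponent e.+2)%N.
Proof.
elim: e => [|e IH]; first by rewrite /crossing_exponent big_geq.
rewrite crossing_exponentS; apply: leq_trans IH _.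
by rewrite leq_pmulr // addn1.
Qed.

Lemma large_crossing_system (R : realFieldType) e :
  exists2 c, (0 < c)%N & forall (I : finType) (v : I -> 'rV[R]_e.+3) (S : {set I}) m,
    general v S -> pointed v S -> (c * m ^ crossing_exponent e.+2 <= #|S|)%N ->
    crossing_system v S m.
Proof.
elim: e => [|e [c c0 IH]].
  exists 64 => // I v S m gS pS.
  by rewrite /crossing_exponent big_geq // muln1; apply: plane_crossing_system.
rewrite crossing_exponentS.
exact: crossing_step (isT : (1 < e.+2)%N) c0 (crossing_exponent_gt1 e) IH.
Qed.

Section Translation.
Context {R : realType} {d : nat} {I : finType} (pt : I -> 'rV[R]_d) (P : {fset 'rV[R]_d}).
Hypotheses (pt_inj : injective pt) (ptP : forall u, pt u \in P).
Implicit Types F G : {set I}.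

Definition homogenize (x : 'rV[R]_d) : 'rV[R]_d.+1 := row_mx (const_mx 1 : 'rV[R]_1) x.

Let v (u : I) := homogenize (pt u).

Definition vertices F : {fset 'rV[R]_d} := [fset pt u | u in F]%fset.

Let perm_enum F : perm_eq (enum_finmem (mem F)) (enum F).
Proof.
apply: uniq_perm; [exact: enum_finmem_uniq|exact: enum_uniq|move=> u].
by rewrite enum_finmemE ?mem_enum.
Qed.

Lemma sum_vertices (V : nmodType) F (f : 'rV[R]_d -> V) :
  \sum_(x <- vertices F) f x = \sum_(u in F) f (pt u).
Proof.
rewrite big_imfset /=; last by move=> x y _ _; apply: pt_inj.
by rewrite (perm_big _ (perm_enum F)) /= big_enum.
Qed.

Lemma card_vertices F : #|` vertices F| = #|F|.
Proof.
by rewrite card_imfset /=; [rewrite (perm_size (perm_enum F)) cardE|apply: pt_inj].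
Qed.

Lemma mem_vertices F (u : I) : (pt u \in vertices F) = (u \in F).
Proof.
apply/imfsetP/idP => [[u' u'F /pt_inj ->]//|uF].
by exists u.
Qed.

Lemma verticesP F x : reflect (exists2 u : I, u \in F & x = pt u) (x \in vertices F).
Proof.
by apply: (iffP idP) => [/imfsetP[u uF ->]|[u uF ->]]; [exists u|rewrite mem_vertices].
Qed.

Lemma vertices_sub F : (vertices F `<=` P)%fset.
Proof. by apply/fsubsetP => x /verticesP[u _ ->]; apply: ptP. Qed.

Let homogenize0 x : homogenize x 0 0 = 1.
Proof. by rewrite /homogenize mxE; case: splitP => j //= _; rewrite mxE. Qed.

Let homogenizeS x j : homogenize x 0 (lift 0 j) = x 0 j.
Proof.
rewrite /homogenize mxE; case: splitP => k /=; first by rewrite ord1.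
by rewrite /bump /= => /addnI ejk; congr (x 0 _); apply: val_inj.
Qed.

Lemma pairing_homogenize (h : 'cV[R]_d.+1) x :
  pairing h (homogenize x) = h 0 0 + (x *m row' 0 h) 0 0.
Proof.
rewrite pairing_recl homogenize0 mul1r; congr (_ + _).
by rewrite /pairing; congr ((_ *m _) 0 0); apply/rowP => j; rewrite mxE homogenizeS.
Qed.

Lemma pointed_homogenize (A : {set I}) : pointed v A.
Proof.
exists (delta_mx 0 0) => u _; rewrite pairing_homogenize mxE !eqxx.
rewrite (_ : row' 0 _ = 0) ?mulmx0 ?mxE ?addr0 ?ltr01 //.
by apply/colP => i; rewrite !mxE.
Qed.

(** A form vanishing on all but one of d+1 dependent vectors can be made to vanish on the last one
    too. Its linear part is nonzero, as otherwise the first coordinates 1 would kill its constant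
    term as well. *)
Lemma general_homogenize : general_position P -> general v [set: I].
Proof.
move=> gP T _ cT w w0 u0 u0T; apply/eqP; apply: contraT => wu0; exfalso.
have [|h h0 hv] := @vanishing_form R d.+1 _ v (T :\ u0).
  by have := cardsD1 u0 T; rewrite u0T cT add1n => -[<-].
have hT u : u \in T -> pairing h (v u) = 0.
  move=> uT; have [->|neq] := eqVneq u u0; last by rewrite hv // !inE neq.
  have := congr1 (pairing h) w0; rewrite pairing_sum pairing0 (big_setD1 u0) //=.
  rewrite big1 ?addr0 => [/eqP|t tT]; last by rewrite hv ?mulr0.
  by rewrite mulf_eq0 (negbTE wu0) => /eqP.
apply: (gP (vertices T)); first exact: vertices_sub.
  by rewrite card_vertices.
exists (row' 0 h), (- h 0 0); split.
  apply: contra h0 => /eqP r0; apply/eqP/colP => i; rewrite mxE.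
  have := hT u0 u0T; rewrite pairing_homogenize r0 mulmx0 mxE addr0 => h00.
  case: (unliftP 0 i) => [j ->|-> //].
  by have := congr1 (fun m : 'cV[R]_d => m j 0) r0; rewrite !mxE.
move=> _ /verticesP[u uT ->]; rewrite /hyperplane /=.
by have := hT u uT; rewrite pairing_homogenize => /eqP; rewrite addrC addr_eq0 => /eqP.
Qed.

Let sum_homogenize0 F (w : I -> R) :
  (\sum_(u in F) w u *: v u) 0 0 = \sum_(u in F) w u.
Proof. by rewrite summxE; apply: eq_bigr => u _; rewrite mxE homogenize0 mulr1. Qed.

Let sum_homogenizeS F (w : I -> R) j :
  (\sum_(u in F) w u *: v u) 0 (lift 0 j) = (\sum_(u in F) w u *: pt u) 0 j.
Proof.
by rewrite !summxE; apply: eq_bigr => u _; rewrite mxE homogenizeS [RHS]mxE.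
Qed.

Let homogenize_sum F (w : I -> R) : \sum_(u in F) w u = 1 ->
  homogenize (\sum_(u in F) w u *: pt u) = \sum_(u in F) w u *: v u.
Proof.
move=> w1; apply/rowP => j; case: (unliftP 0 j) => [k ->|->].
  by rewrite sum_homogenizeS homogenizeS.
by rewrite sum_homogenize0 homogenize0 w1.
Qed.

Hypothesis gP : general_position P.
Hypothesis cI : (d < #|I|)%N.

Let gv : general v [set: I] := general_homogenize gP.

Let cT : (d < #|[set: I]|)%N.
Proof. by rewrite cardsT. Qed.

Let ext (w : I -> R) (x : 'rV[R]_d) : R := \sum_(u | pt u == x) w u.

Let extE w (u : I) : ext w (pt u) = w u.
Proof. by rewrite /ext (eq_bigl _ _ (fun t => inj_eq pt_inj t u)) big_pred1_eq. Qed.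

Lemma simplex_vertices F : #|F| = d -> simplex_in P (vertices F).
Proof.
move=> cF; split; [exact: vertices_sub|by rewrite card_vertices|].
move=> w; rewrite !sum_vertices => w0 w1 _ /verticesP[u uF ->].
have indF : independent v F.
  by apply: general_independent gv (subsetT _) _ cT; rewrite cF.
apply: (indF (fun u => w (pt u))) => //; apply/rowP => j; rewrite [RHS]mxE.
case: (unliftP 0 j) => [k ->|->]; last by rewrite sum_homogenize0.
by rewrite sum_homogenizeS w1 mxE.
Qed.

Let continuous_pairing h : continuous (fun x : 'rV[R]_d => pairing h (homogenize x)).
Proof.
rewrite (_ : (fun x => _) = fun x : 'rV[R]_d =>
  h 0 0 + \sum_(i < d) x 0 i * row' 0 h i 0); last first.
  by apply/funext => x; rewrite pairing_homogenize mxE.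
have sumc : continuous (fun x : 'rV[R]_d => \sum_(i < d) x 0 i * row' 0 h i 0).
  apply: continuous_big => [|i _ y]; first exact: add_continuous.
  by apply: continuousM; [exact: coord_continuous|exact: cst_continuous].
by move=> x; apply: continuousD; [exact: cst_continuous|exact: sumc].
Qed.

(** Within d+1 independent lifted points containing [F], barycentric coordinates are linear forms.
    Those of [F] are positive at the given point, hence nearby, and on the affine hull they are the
    weights. *)
Lemma interior_vertices F (w : I -> R) : (#|F| <= d)%N ->
    (forall u, u \in F -> 0 < w u) -> \sum_(u in F) w u = 1 ->
  relative_interior (vertices F) (\sum_(u in F) w u *: pt u).
Proof.
move=> cF wpos w1; split.
  exists (ext w); rewrite !sum_vertices; split.
    by rewrite -w1; apply: eq_bigr => u _; rewrite extE.
  by apply: eq_bigr => u _; rewrite extE.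
have [T [sFT _ cTT]] := subset_between (subsetT F) (leqW cF) cT.
have indT := gv (subsetT T) cTT.
(* The form of [u] vanishes on the other points of [T] and is scaled to be 1 at [u]. *)
have dual u : exists h : 'cV[R]_d.+1, u \in F ->
    forall w', pairing h (\sum_(t in F) w' t *: v t) = w' u.
  have [uF|_] := boolP (u \in F); last by exists 0.
  have uT := subsetP sFT u uF.
  have [|h h0 hv] := @vanishing_form R d.+1 _ v (T :\ u).
    by have := cardsD1 u T; rewrite uT cTT add1n => -[<-].
  have hu : pairing h (v u) != 0.
    apply: contra h0 => /eqP hu; apply/eqP; apply: (form_eq0 indT cTT) => t tT.
    by have [->//|neq] := eqVneq t u; rewrite hv // !inE neq.
  exists ((pairing h (v u))^-1 *: h) => _ w'; rewrite pairingZl pairing_sum.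
  rewrite (big_setD1 u) //= big1 ?addr0 => [|t /setD1P[tu tF]].
    by rewrite mulrC mulfK.
  by rewrite hv ?mulr0 // !inE tu (subsetP sFT).
have {dual} [h hP] := choice dual.
set x0 := \sum_(u in F) w u *: pt u.
have FF : Filter (nbhs x0) by exact: nbhs_filter.
have pos1 u : \forall y \near x0, u \in F -> 0 < pairing (h u) (homogenize y).
  have [uF|_] := boolP (u \in F); last by apply: (@filterE _ (nbhs x0) FF) => y.
  have hx : 0 < pairing (h u) (homogenize x0) by rewrite homogenize_sum // hP // wpos.
  near=> y => _; near: y.
  exact: (cvgr_gt _ (@continuous_pairing (h u) x0) 0 hx).
have pos := filter_forall (@nbhs_filter _ x0) pos1.
near=> y => -[w' [w'1 ey]].
exists w'; split=> // _ /verticesP[u uF ->].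
have : forall u, u \in F -> 0 < pairing (h u) (homogenize y) by near: y.
move=> /(_ u uF); rewrite ey; move: w'1; rewrite !sum_vertices => w'1.
by rewrite (homogenize_sum w'1) hP // => /ltW.
Unshelve. all: by end_near. Qed.

Lemma cross_vertices F G : (0 < d)%N -> #|F| = d -> #|G| = d -> [disjoint F & G] ->
  cone_cross v F G -> strongly_cross (vertices F) (vertices G).
Proof.
move=> d0 cF cG dis [w wpos ew]; split; last first.
  apply/fdisjointP => _ /verticesP[u uF ->]; rewrite mem_vertices.
  by rewrite (disjointFr dis).
set s := \sum_(u in F) w u.
have wF u : u \in F -> 0 < w u by move=> uF; apply: wpos; rewrite inE uF.
have wG u : u \in G -> 0 < w u by move=> uG; apply: wpos; rewrite inE uG orbT.
have s0 : 0 < s.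
  have /card_gt0P[u uF] : (0 < #|F|)%N by rewrite cF.
  by rewrite /s (big_setD1 u) //= ltr_pwDl ?wF // sumr_ge0 // => t /setD1P[_ /wF/ltW].
have sG : \sum_(u in G) w u = s.
  by rewrite -sum_homogenize0 -ew sum_homogenize0.
have e2 : \sum_(u in F) w u *: pt u = \sum_(u in G) w u *: pt u.
  by apply/rowP => j; rewrite -!sum_homogenizeS ew.
exists (\sum_(u in F) (s^-1 * w u) *: pt u); split.
  apply: interior_vertices => [|u uF|]; first by rewrite cF.
    by rewrite mulr_gt0 ?invr_gt0 ?wF.
  by rewrite -mulr_sumr mulVf // gt_eqF.
have -> : \sum_(u in F) (s^-1 * w u) *: pt u = \sum_(u in G) (s^-1 * w u) *: pt u.
  under eq_bigr do rewrite -scalerA; under [RHS]eq_bigr do rewrite -scalerA.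
  by rewrite -!scaler_sumr e2.
apply: interior_vertices => [|u uG|]; first by rewrite cG.
  by rewrite mulr_gt0 ?invr_gt0 ?wG.
by rewrite -mulr_sumr sG mulVf // gt_eqF.
Qed.

Lemma crossing_family_of_system m : (0 < d)%N -> crossing_system v [set: I] m ->
  exists2 F : {fset {fset 'rV[R]_d}}, crossing_family P F & #|` F| = m.
Proof.
move=> d0 [F FP FX]; have cF i : #|F i| = d by have [] := FP i.
have F_inj : injective (fun i => vertices (F i)).
  move=> i j eF; apply/eqP; apply: contraT => ij; have [dis _] := FX i j ij.
  have /card_gt0P[u uF] : (0 < #|F i|)%N by rewrite cF.
  by have := mem_vertices (F i) u; rewrite eF mem_vertices uF (disjointFr dis).
exists [fset vertices (F i) | i in 'I_m]%fset.
  split=> [_ /imfsetP[i _ ->]|_ _ /imfsetP[i _ ->] /imfsetP[j _ ->] neq].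
    exact: simplex_vertices.
  have ij : i != j by apply: contra neq => /eqP ->.
  by have [dis cc] := FX i j ij; apply: cross_vertices.
by rewrite card_imfset //= -cardE card_ord.
Qed.

End Translation.

(** For the largest m, n is below c (m+1)^p, and m+1 is at most 2m because m is positive. *)
Lemma largest_power c p n : (0 < c)%N -> (0 < p)%N -> (c <= n)%N ->
  exists m, (c * m ^ p <= n)%N /\ (n <= (2 * c * m) ^ p)%N.
Proof.
move=> c0 p0 cn; have exP : exists m, (c * m ^ p <= n)%N by exists 1%N; rewrite exp1n muln1.
have bound m : (c * m ^ p <= n)%N -> (m <= n)%N.
  move=> le; apply: leq_trans le; apply: leq_trans (_ : m ^ p <= _)%N.
    by case: m => // m; rewrite -{1}[m.+1]expn1 leq_pexp2l.
  by rewrite leq_pmull.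
have [m mP mmax] := ex_maxnP exP bound; exists m; split=> //.
have m0 : (0 < m)%N by apply: mmax; rewrite exp1n muln1.
have : (n < c * m.+1 ^ p)%N by rewrite ltnNge; apply/negP => /mmax; rewrite ltnn.
move/ltnW/leq_trans; apply; rewrite mulnAC expnMn.
apply: leq_trans (_ : c ^ p * (2 * m) ^ p <= _)%N; last by rewrite -!expnMn; apply: leq_expn2r; lia.
apply: leq_mul; first by rewrite -{1}[c]expn1 leq_pexp2l.
by apply: leq_expn2r; lia.
Qed.

Theorem corollary3p5 (R : realType) (d : nat) (hd : (2 <= d)%N) :
  exists2 C : R, 0 < C &
  exists N : nat, forall n : nat, (N <= n)%N ->
  forall P : {fset 'rV[R]_d}, #|` P| = n -> general_position P ->
  exists2 F : {fset {fset 'rV[R]_d}}, crossing_family P F &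
    (d = 2%N -> C * Num.sqrt n%:R <= #|` F|%:R) /\
    ((3 <= d)%N ->
       C * n%:R `^ ((2 * \prod_(3 <= i < d.+1) (i ^ 2 - i + 1))%N%:R)^-1
         <= #|` F|%:R).
Proof.
case: d hd => [|[|e]] // _; have [c c0 hc] := large_crossing_system R e.
have p1 := crossing_exponent_gt1 e; have p0 := ltnW p1.
have C0 : (0 : R) < (2 * c)%:R by rewrite ltr0n muln_gt0.
exists (2 * c)%:R^-1; first by rewrite invr_gt0.
(* n >= c makes m positive in [largest_power], and n >= e+3 supplies the d+1 points needed for
   general position. *)
exists (c + e.+3)%N => n le_n P cP gP.
have [m [mn nm]] := largest_power c0 p0 (leq_trans (leq_addr _ _) le_n).
pose pt (i : 'I_n) : 'rV[R]_e.+2 := nth 0 (P : seq _) i.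
have pt_inj : injective pt.
  move=> i j /eqP; rewrite nth_uniq ?fset_uniq -?cardfE ?cP //.
  by move/eqP/val_inj.
have ptP u : pt u \in P by rewrite mem_nth // cP.
have [||F crF cF] := @crossing_family_of_system R e.+2 'I_n pt P pt_inj ptP gP _ m isT _.
- by rewrite card_ord; apply: leq_trans le_n; rewrite leq_addl.
- apply: hc; first exact: general_homogenize.
    exact: pointed_homogenize.
  by rewrite cardsT card_ord.
exists F => //; rewrite cF; have mE : (2 * c)%:R * m%:R = (2 * c * m)%:R :> R by rewrite -natrM.
split=> [[e0]|_]; rewrite ler_pdivrMl // mE.
  rewrite -[leRHS]ger0_norm // -sqrtr_sqr -natrX; apply: ler_wsqrtr.
  by move: nm; rewrite e0 /crossing_exponent big_geq // ler_nat.
rewrite -/(crossing_exponent e.+2); set p := crossing_exponent _ in nm p0 *.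
apply: le_trans (_ : ((2 * c * m) ^ p)%:R `^ p%:R^-1 <= _).
  by apply: ge0_ler_powR; rewrite ?nnegrE ?invr_ge0 ?ler_nat.
by rewrite natrX -powR_mulrn // -powRrM divff ?powRr1 // pnatr_eq0 -lt0n.
Qed.
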